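(* The wave function $\varPsi_n$ satisfies the linear equations $$\vartheta_m\varPsi_n=\mathscr P_m(\vartheta_\eta)\varPsi_n,\qquad \mathscr P_m(\vartheta_\eta)=\vartheta_\eta^m-m\,\vartheta_\eta(p^1_n)\,\vartheta_\eta^{m-2}+U_{n,m-3}\vartheta_\eta^{m-3}+\cdots+U_{n,0},$$ where $\{U_{n,j}\}_{j=0}^{m-3}$ are polynomials in $\vartheta_\eta^l p^1_n,\vartheta_2p^1_n,\dots,\vartheta_{m-1}p^1_n$. In particular, the following linear equations hold: $$\vartheta_2\varPsi_n=\vartheta_\eta^2\varPsi_n-2\vartheta_\eta(p^1_n)\varPsi_n,$$ $$\vartheta_3\varPsi_n=\vartheta_\eta^3\varPsi_n-3\vartheta_\eta(p^1_n)\vartheta_\eta\varPsi_n-\frac32\Big(\vartheta_\eta^2(p^1_n)+\vartheta_2(p^1_n)\Big)\varPsi_n,$$ and, consequently, their compatibility condition, which is the KP equation $$\vartheta_\eta\Big(4\vartheta_3(p^1_n)+6\big(\vartheta_\eta(p^1_n)\big)^2-\vartheta_\eta^3(p^1_n)\Big)=\vartheta_2^2(p^1_n),$$ is fulfilled.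
   Context: $n\in\mathbb N_0=\{0,1,2,\dots\}$ and $m\ge2$. Let $\boldsymbol\eta=(\eta_1,\eta_2,\dots)$ be deformation parameters, $\eta:=\eta_1$, $t_l=\log\eta_l$, and $\mathscr E(z;\boldsymbol\eta)=\prod_{l\ge1}\eta_l^{z^l}=\exp\big(\sum_{l\ge1}t_lz^l\big)$. Derivatives: $\vartheta_l=\eta_l\,\partial/\partial\eta_l=\partial/\partial t_l$ and $\vartheta_\eta=\vartheta_1$. The weight is $w(z)=v(z)\mathscr E(z;\boldsymbol\eta)$ with $v$ independent of $\boldsymbol\eta$, and the functional is $\rho=\sum_{k=0}^\infty\delta(z-k)w(k)$. It is assumed that the moments $\rho_n=\sum_{k=0}^\infty k^nw(k)$ converge and may be differentiated termwise in the $\eta_l$ (with $|\eta_l|\le1$ for $l\ge2$), and that all leading principal minors of $(\rho_{n+m})_{n,m\in\mathbb N_0}$ are nonzero. Then $P_n(z)=z^n+p^1_nz^{n-1}+\dots+p^n_n$ ($p^1_0=0$) are the monic orthogonal polynomials: $\sum_{k=0}^\infty P_n(k)k^jw(k)=0$ for $0\le j<n$. The wave function is $\varPsi=P\,\mathscr E$, $P=(P_0,P_1,\dots)^\top$, i.e. $\varPsi_n(z)=P_n(z)\mathscr E(z;\boldsymbol\eta)$.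
   Formalization: The KP right-hand side is corrected to 3ϑ_2²(p^1_n) (without the 3 it fails for the Charlier weight, n=1); the U_{n,j} are polynomials in ϑ_η^a ϑ_b p^1_n with a≥0, 1≤b≤m−1, since for m=4 the mixed term ϑ_ηϑ_2 p^1_n is needed. *)

(* Defs.v *)
From HB Require Import structures.
From mathcomp Require Import all_boot all_order all_algebra.
From mathcomp Require Import all_classical all_reals all_analysis.
From mathcomp Require Import complex.
From mathcomp Require mpoly.

Set Implicit Arguments.
Unset Strict Implicit.
Unset Printing Implicit Defensive.

Import Order.TTheory GRing.Theory Num.Theory numFieldNormedType.Exports.
Local Open Scope classical_set_scope.
Local Open Scope ring_scope.

(* R[i] seen as a numFieldType: MathComp-Analysis attaches the norm topology
   to abstract numFieldTypes, not to the bare type R[i]. *)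
Definition Cx (R : realType) : numFieldType := R[i].

Definition expC (R : realType) (z : Cx R) : Cx R :=
  let: (x +i* y)%C := z in (expR x * cos y +i* (expR x * sin y))%C.

(* A parameter is the sequence t = (t_1, t_2, ...), t_l = log eta_l; the entry
   of index 0 is unused.  Working with t fixes the branch of log eta_l needed
   to evaluate eta_l^(z^l) at an arbitrary complex z. *)
Definition param (R : realType) : Type := nat -> Cx R.

Definition deform (R : realType) (t : param R) (z : Cx R) : Cx R :=
  expC (limn (series (fun l => t l.+1 * z ^+ l.+1))).

Definition translate (R : realType) (t : param R) (l : nat) (s : Cx R) : param R :=
  fun i => if i == l then t i + s else t i.

(* Increments s <> 0, s -> 0, of the coordinate t_l that stay in Om. *)
Definition increments (R : realType) (Om : set (param R)) (l : nat)
    (t : param R) : set_system (Cx R) :=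
  within [set s | Om (translate t l s)] 0^'.

Definition diffq (R : realType) (f : param R -> Cx R) (l : nat)
    (t : param R) (s : Cx R) : Cx R :=
  s^-1 * (f (translate t l s) - f t).

(* f has derivative d with respect to t_l at t, relatively to the domain Om.
   The relative derivative is needed because the parameters of interest may be
   on the boundary of the domain: eta_l = 1 (no deformation in the direction l)
   is on the boundary of |eta_l| <= 1, and the moments may well diverge for
   |eta_l| > 1. *)
Definition is_theta (R : realType) (Om : set (param R)) (l : nat)
    (f : param R -> Cx R) (t : param R) (d : Cx R) : Prop :=
  diffq f l t @ increments Om l t --> d.

Definition theta (R : realType) (Om : set (param R)) (l : nat)
    (f : param R -> Cx R) (t : param R) : Cx R :=
  lim (diffq f l t @ increments Om l t).

(* k-th iterate of theta_eta = theta_1 *)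
Definition theta_eta (R : realType) (Om : set (param R)) (k : nat)
    (f : param R -> Cx R) : param R -> Cx R :=
  iter k (theta Om 1) f.

Definition weight (R : realType) (v : nat -> Cx R) (t : param R) (k : nat) :
    Cx R :=
  v k * deform t k%:R.

Definition moment (R : realType) (v : nat -> Cx R) (n : nat) (t : param R) :
    Cx R :=
  limn (series (fun k => k%:R ^+ n * weight v t k)).

Record deformed_orthogonality (R : realType) (v : nat -> Cx R)
    (Om : set (param R)) (P : nat -> param R -> {poly Cx R}) : Prop := {
  eta_le1 : forall t l, Om t -> (2 <= l)%N -> `|expC (t l)| <= 1;
  deform_cvg : forall t (z : Cx R), Om t ->
    cvgn (series (fun l => t l.+1 * z ^+ l.+1));
  (* the partial derivatives relative to Om make sense at every point of Om *)
  domain_accessible : forall t l, Om t -> (1 <= l)%N ->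
    limit_point [set s : Cx R | Om (translate t l s)] 0;
  moment_cvg : forall t n, Om t ->
    cvgn (series (fun k => k%:R ^+ n * weight v t k));
  moment_termwise : forall t n l, Om t -> (1 <= l)%N ->
    is_theta Om l (moment v n) t
      (limn (series (fun k =>
         theta Om l (fun t' => k%:R ^+ n * weight v t' k) t)));
  minors_neq0 : forall t N, Om t ->
    \det (\matrix_(i < N, j < N) moment v (i + j) t) != 0;
  poly_monic : forall t n, Om t -> P n t \is monic /\ size (P n t) = n.+1;
  poly_orthogonal : forall t n j, Om t -> (j < n)%N ->
    limn (series (fun k => (P n t).[k%:R] * k%:R ^+ j * weight v t k)) = 0
}.

Definition p1 (R : realType) (P : nat -> param R -> {poly Cx R}) (n : nat)
    (t : param R) : Cx R :=
  if n is n'.+1 then (P n t)`_n' else 0.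

Definition wave (R : realType) (P : nat -> param R -> {poly Cx R}) (n : nat)
    (z : Cx R) (t : param R) : Cx R :=
  (P n t).[z] * deform t z.

(* Main.v *)
(* Moments satisfy theta_l rho_n = rho_(n+l), so the functions built from moments
   and deform by ring operations and inverses form a differential algebra on
   which the theta_l commute; by Cramer's rule it contains the coefficients of
   P_n.  Orthogonality to 1, ..., z^(n-1) is preserved by d + z (d = theta_1)
   and by theta_m + z^m.  Hence, if the u_i are chosen so that
     theta_m P + z^m P - (d + z)^m P - sum_i u_i (d + z)^(m-i) P
   has degree < n, this polynomial vanishes, which is the equation for theta_m.
   Let x = 1/z and P_n = z^n S(x).  With d S = h S one has
   (d + z)^j P = z^j F_j P, where F_0 = 1 and F_(j+1) = F_j + x (d F_j + h F_j);
   so the u_i depend only on the jets of h, and not on S itself.  The coefficient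
   of z^(n-1) reads theta_m p^1 = m h_m + (jets of h_1, ..., h_(m-1)), and this
   expresses every h_m through the theta_1^a theta_b p^1 with b <= m.  The KP
   equation is the commutation of theta_1 and theta_2 on the coefficient of x^2
   in S. *)
Require Import Defs.
From HB Require Import structures.
From mathcomp Require Import all_boot all_order all_algebra.
From mathcomp Require Import all_classical all_reals all_analysis.
From mathcomp Require Import complex.
From mathcomp Require mpoly.
From mathcomp Require Import ring lra.

Set Implicit Arguments.
Unset Strict Implicit.
Unset Printing Implicit Defensive.

Import Order.TTheory GRing.Theory Num.Theory numFieldNormedType.Exports.
Local Open Scope classical_set_scope.
Local Open Scope ring_scope.

(** * The complex exponential and its derivative at 0 *)

Section ExpC.
Variable R : realType.
Implicit Types z w : Cx R.

Lemma expCD z w : expC (z + w) = expC z * expC w.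
Proof.
case: z w => [a b] [c d] /=; rewrite expRD sinD cosD.
apply/eqP; rewrite eq_complex /=; apply/andP; split; apply/eqP; ring.
Qed.

Lemma expC0 : expC (0 : Cx R) = 1.
Proof. by rewrite /= expR0 cos0 sin0 mulr0 mulr1. Qed.

(** The derivative is recast as a bound that also covers x = 0, so that the estimates for exp, cos
    and sin can be multiplied and added. *)
Lemma derive_quotient (f : R -> R) (d : R) : f 0 = 0 -> is_derive (0 : R) 1 f d ->
  forall e : R, 0 < e -> \forall x \near (0 : R), `|f x - d * x| <= e * `|x|.
Proof.
move=> f0 [df fd] e e0.
have : h^-1 *: (f (h *: 1 + 0) - f 0) @[h --> (0:R)^'] --> d.
  by rewrite -fd; exact: df.
move=> /cvgrPdist_le /(_ e e0).
rewrite near_withinE => Hf.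
near=> x.
have [->|x0] := eqVneq x 0; first by rewrite f0 mulr0 subr0 !normr0 mulr0.
have : `|d - x^-1 *: (f (x *: 1 + 0) - f 0)| <= e by apply: (near Hf x).
rewrite f0 subr0 addr0 /GRing.scale /= mulr1 => Hx.
have -> : f x - d * x = - ((d - x^-1 * f x) * x) by field.
by rewrite normrN normrM ler_wpM2r.
Unshelve. all: by end_near. Qed.

Lemma normc_ge_Im (z : R[i]) : ((`|complex.Im z|)%:C <= `|z|)%C.
Proof.
by case: z => a b; rewrite normc_def lecR -sqrtr_sqr ler_wsqrtr //= lerDr sqr_ge0.
Qed.

Lemma near_Re_Im (A : set R) : (\forall x \near (0 : R), A x) ->
  \forall s \near (0 : Cx R), A (complex.Re s) /\ A (complex.Im s).
Proof.
move=> /(@nbhs_norm0P R R^o)[e /= e0 eA].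
apply/(@nbhs_norm0P (Cx R) (Cx R)^o); exists (e%:C)%C; first by rewrite /= ltcR.
move=> s /= se.
by split; apply: eA => /=; rewrite -ltcR; apply: le_lt_trans se;
  [exact: normc_ge_Re | exact: normc_ge_Im].
Qed.

(** For s = x + iy the real part is exp x (cos y - 1) + (exp x - 1 - x) and the imaginary part is
    exp x (sin y - y) + (exp x - 1) y. Each summand is small by a real derivative at 0, since |x|
    and |y| are at most |s|. *)
Lemma expC_sub1_near0 (e : R) : 0 < e ->
  \forall s \near (0 : Cx R), `|expC s - 1 - s| <= (e%:C)%C * `|s|.
Proof.
move=> e0.
(* The real part will cost 3 d |s| and the imaginary part 4 d |s|. *)
have d0 : 0 < e / 7 by rewrite divr_gt0.
set d := e / 7 in d0 *.
have Hexp c : 0 < c -> \forall x \near (0:R), `|expR x - 1 - 1 * x| <= c * `|x|.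
  apply: (@derive_quotient (fun x => expR x - 1)); first by rewrite expR0 subrr.
  by apply: is_derive_eq; rewrite expR0; exact: (subr0 (1 : R)).
have Hcos : \forall x \near (0:R), `|cos x - 1 - 0 * x| <= d * `|x|.
  apply: (@derive_quotient (fun x => cos x - 1)) => //; first by rewrite cos0 subrr.
  by apply: is_derive_eq; rewrite sin0 -[LHS]/(- 0 - 0 : R) oppr0 addr0.
have Hsin : \forall x \near (0:R), `|sin x - 1 * x| <= d * `|x|.
  apply: (@derive_quotient sin) => //; first by rewrite sin0.
  by apply: is_derive_eq; rewrite cos0.
have Hd : \forall x \near (0:R), `|x| <= d.
  have := @nbhs0_le R R^o d d0; apply.
(* With |exp x - 1| <= 2 |x| this yields |exp x| <= 2. *)
have H2 : \forall x \near (0:R), `|x| <= 2^-1.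
  by have := @nbhs0_le R R^o 2^-1; apply; rewrite invr_gt0.
have HH : \forall x \near (0:R), [/\ `|expR x - 1 - 1 * x| <= d * `|x|,
    `|expR x - 1 - 1 * x| <= 1 * `|x|, `|cos x - 1 - 0 * x| <= d * `|x|,
    `|sin x - 1 * x| <= d * `|x| & `|x| <= d] /\ `|x| <= 2^-1.
  near=> x; split; last exact: (near H2 x).
  split; [exact: (near (Hexp _ d0) x)|exact: (near (Hexp _ ltr01) x)|
    exact: (near Hcos x)|exact: (near Hsin x)|exact: (near Hd x)].
apply: filterS (near_Re_Im HH) => s [[[hx1 hx2 _ _ hx3] hx4] [[_ _ hy1 hy2 _] _]].
set x := complex.Re s in hx1 hx2 hx3 hx4 *.
set y := complex.Im s in hy1 hy2 *.
have sE : s = (x +i* y)%C by rewrite /x /y; case: (s).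
have [nrm sn] : exists r : R, `|s| = (r%:C)%C.
  by rewrite normc_def; eexists.
have xs : `|x| <= nrm by rewrite -lecR -sn; exact: (normc_ge_Re s).
have ys : `|y| <= nrm by rewrite -lecR -sn; exact: (normc_ge_Im s).
clearbody x y.
rewrite mul0r subr0 in hy1; rewrite !mul1r in hx1 hx2 hy2.
have hx5 : `|expR x - 1| <= 2 * `|x|.
  have -> : expR x - 1 = (expR x - 1 - x) + x by ring.
  apply: le_trans (ler_normD _ _) _; lra.
have hx6 : `|expR x| <= 2.
  have -> : expR x = (expR x - 1) + 1 by ring.
  apply: le_trans (ler_normD _ _) _; rewrite normr1; lra.
have hre : `|expR x * cos y - 1 - x| <= 3 * d * nrm.
  have -> : expR x * cos y - 1 - x = expR x * (cos y - 1) + (expR x - 1 - x) by ring.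
  apply: le_trans (ler_normD _ _) _; rewrite normrM.
  have := ler_pM (normr_ge0 _) (normr_ge0 _) hx6 hy1.
  have := ler_wpM2l (ltW d0) xs; have := ler_wpM2l (ltW d0) ys; lra.
have him : `|expR x * sin y - y| <= 4 * d * nrm.
  have -> : expR x * sin y - y = expR x * (sin y - y) + (expR x - 1) * y by ring.
  apply: le_trans (ler_normD _ _) _; rewrite !normrM.
  have A1 := ler_pM (normr_ge0 _) (normr_ge0 _) hx6 hy2.
  have A2 : `|expR x - 1| * `|y| <= 2 * (d * `|y|).
    apply: le_trans (ler_wpM2r (normr_ge0 y) hx5) _.
    by rewrite -mulrA ler_pM2l // ler_wpM2r.
  have A3 := ler_wpM2l (ltW d0) ys.
  apply: le_trans (lerD A1 A2) _; lra.
have -> : expC s - 1 - s =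
    ((expR x * cos y - 1 - x)%:C + (expR x * sin y - y)%:C * 'i)%C.
  rewrite {}sE /=; apply/eqP; rewrite eq_complex /=; apply/andP; split; apply/eqP; ring.
apply: le_trans (ler_normD _ _) _; rewrite normrM.
have -> : `|('i%C : R[i])| = 1.
  by rewrite normc_def /= expr0n expr1n add0r sqrtr1.
rewrite mulr1.
have nC (a : R) : `|(a%:C)%C| = (`|a|%:C)%C.
  by rewrite normc_def /= expr0n addr0 sqrtr_sqr.
rewrite sn !nC -rmorphD -rmorphM lecR.
have eE : e = 7 * d by rewrite /d; field.
rewrite eE; lra.
Unshelve. all: by end_near. Qed.

Lemma expC_derivative0 : s^-1 * (expC s - 1) @[s --> (0 : Cx R)^'] --> (1 : Cx R).
Proof.
apply/cvgrPdist_le => e e0.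
have [r r0 re] : exists2 r : R, 0 < r & (r%:C)%C = e.
  case: e e0 => [a b]; rewrite ltcE /= => /andP[/eqP -> a0]; by exists a.
rewrite near_withinE; near=> s => s0.
have h : `|expC s - 1 - s| <= (r%:C)%C * `|s| by apply: (near (expC_sub1_near0 r0) s).
have -> : 1 - s^-1 * (expC s - 1) = - (s^-1 * (expC s - 1 - s)).
  by field.
rewrite normrN normrM normfV -re mulrC ler_pdivrMr // normr_gt0 //.
Unshelve. all: by end_near. Qed.

End ExpC.

(** * Derivatives along a coordinate, relative to the domain *)

Section ThetaCalculus.
Variables (R : realType) (Om : set (param R)).
Implicit Types (f g : param R -> Cx R) (t : param R) (l : nat) (a b : Cx R).

Global Instance increments_filter l t : Filter (increments Om l t).
Proof. exact: within_filter. Qed.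

Lemma near_increments l t (A : set (Cx R)) :
  (forall s, s != 0 -> Om (translate t l s) -> A s) -> \forall s \near increments Om l t, A s.
Proof.
move=> H; rewrite /increments !near_withinE; near=> s => s0 st; exact: H.
Unshelve. all: by end_near. Qed.

Lemma cvg_increments l t (T : topologicalType) (u : Cx R -> T) (x : T) :
  u s @[s --> (0 : Cx R)^'] --> x -> u s @[s --> increments Om l t] --> x.
Proof. by apply: cvg_trans; apply: cvg_app; exact: cvg_within. Qed.

Lemma increments_to0 l t : s @[s --> increments Om l t] --> (0 : Cx R).
Proof.
by apply: (@cvg_increments l t _ id); apply: cvg_trans; [exact: cvg_within|exact: cvg_id].
Qed.

Lemma is_theta_ext l f g t d : Om t -> (forall t', Om t' -> f t' = g t') ->
  is_theta Om l f t d -> is_theta Om l g t d.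
Proof.
move=> tO fg; apply: cvg_trans; apply: near_eq_cvg.
by apply: near_increments => s _ st; rewrite /diffq !fg.
Qed.

Lemma is_theta_cst l t a : is_theta Om l (fun=> a) t 0.
Proof.
by rewrite /is_theta /diffq; under eq_fun do rewrite subrr mulr0; exact: cvg_cst.
Qed.

Lemma is_thetaD l f g t a b : is_theta Om l f t a -> is_theta Om l g t b ->
  is_theta Om l (fun t => f t + g t) t (a + b).
Proof.
move=> fa gb; apply: cvg_trans (cvgD fa gb); apply: near_eq_cvg.
near=> s; rewrite /diffq ?fctE /=; ring.
Unshelve. all: by end_near. Qed.

(** The value at the translate is f(t) + s [diffq], with s tending to 0. The product and inverse
    rules rely on this. *)
Lemma is_theta_continuous l f t a : is_theta Om l f t a ->
  f (translate t l s) @[s --> increments Om l t] --> f t.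
Proof.
move=> fa; rewrite -[X in _ --> X]addr0 -(mul0r a).
have H : f t + s * diffq f l t s @[s --> increments Om l t] --> f t + 0 * a.
  exact: cvgD (cvg_cst _) (cvgM (increments_to0 l t) fa).
apply: cvg_trans H; apply: near_eq_cvg.
by apply: near_increments => s s0 _; rewrite /diffq ?fctE /=; field.
Qed.

Lemma is_thetaM l f g t a b : is_theta Om l f t a -> is_theta Om l g t b ->
  is_theta Om l (fun t => f t * g t) t (a * g t + f t * b).
Proof.
move=> fa gb.
apply: cvg_trans (cvgD (cvgM fa (is_theta_continuous gb)) (cvgM (cvg_cst (f t)) gb)).
apply: near_eq_cvg; near=> s; rewrite /diffq ?fctE /=; ring.
Unshelve. all: by end_near. Qed.

Lemma is_thetaV l f t a : Om t -> (forall t', Om t' -> f t' != 0) ->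
  is_theta Om l f t a -> is_theta Om l (fun t => (f t)^-1) t (- (a * (f t ^+ 2)^-1)).
Proof.
move=> tO f0 fa; have ft := f0 _ tO.
have ft2 : f t * f t != 0 by rewrite mulf_neq0.
have H : - (diffq f l t s * (f (translate t l s) * f t)^-1)
    @[s --> increments Om l t] --> - (a * (f t * f t)^-1).
  exact: cvgN (cvgM fa (cvgV ft2 (cvgM (is_theta_continuous fa) (cvg_cst _)))).
rewrite expr2; apply: cvg_trans H; apply: near_eq_cvg; apply: near_increments => s s0 st.
rewrite /diffq ?fctE /=; field; rewrite s0 ft f0 //.
Qed.

Hypothesis acc : forall t l, Om t -> (1 <= l)%N ->
  limit_point [set s : Cx R | Om (translate t l s)] 0.

(** Accessibility of the domain provides nonzero increments arbitrarily close to 0. Limits are then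
    unique, so [theta] is the derivative whenever one exists. *)
Lemma increments_proper l t : Om t -> (1 <= l)%N -> ProperFilter (increments Om l t).
Proof.
move=> tO l0; split; last exact: within_filter.
rewrite /increments /within /= => H.
have [y [y0 Oy]] := acc tO l0 H.
by apply.
Qed.

Lemma is_theta_theta l f t d : Om t -> (1 <= l)%N -> is_theta Om l f t d ->
  theta Om l f t = d.
Proof.
move=> tO l0 fd; have := increments_proper tO l0 => FF.
by apply: cvg_lim fd; exact: norm_hausdorff.
Qed.

End ThetaCalculus.

(** * Differentiation of the deformation factor *)

Section Deform.
Variables (R : realType) (Om : set (param R)).
Hypothesis cvg_deform : forall t (z : Cx R), Om t ->
  cvgn (series (fun l => t l.+1 * z ^+ l.+1)).

Lemma series_single (c : Cx R) (k : nat) :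
  series (fun j => if j == k then c else 0) n @[n --> \oo] --> c.
Proof.
apply: cvg_near_cst; exists k.+1 => // n /= kn.
rewrite /series /= (bigD1_seq k) ?iota_uniq ?mem_index_iota //= eqxx.
by rewrite big1 ?addr0 // => i /negbTE ->.
Qed.

(** Translation alters a single term of the series in the exponent, by s z^l, and [expC] turns this
    sum into a product. *)
Lemma deform_translate (t : param R) (l : nat) (s z : Cx R) :
  Om t -> Om (translate t l s) -> (1 <= l)%N ->
  deform (translate t l s) z = deform t z * expC (s * z ^+ l).
Proof.
case: l => // l tO sO _; rewrite /deform -expCD; congr expC.
have H : series (fun j => translate t l.+1 s j.+1 * z ^+ j.+1) =
    series (fun j => t j.+1 * z ^+ j.+1) \+ series (fun j => if j == l then s * z ^+ l.+1 else 0).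
  apply/funext => n; rewrite /series /= -big_split; apply: eq_bigr => j _.
  rewrite /translate eqSS; case: eqP => [->|_]; first by rewrite mulrDl.
  by rewrite /= addr0.
rewrite H; apply: cvg_lim; first exact: norm_hausdorff.
by apply: cvgD; [apply: cvg_deform|apply: series_single].
Qed.

Lemma is_theta_deform (t : param R) (l : nat) (z : Cx R) : Om t -> (1 <= l)%N ->
  is_theta Om l (fun t' => deform t' z) t (z ^+ l * deform t z).
Proof.
move=> tO l0; set c := z ^+ l.
have H : s^-1 * (expC (s * c) - 1) @[s --> (0 : Cx R)^'] --> c.
  (* The substitution s -> s c stays in the punctured neighbourhood of 0 only if c is nonzero. *)
  have [->|c0] := eqVneq c 0.
    under eq_fun do rewrite mulr0 expC0 subrr mulr0; exact: cvg_cst.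
  have sc : s * c @[s --> (0 : Cx R)^'] --> (0 : Cx R)^'.
    move=> A; rewrite /= /within /= => /nbhs_norm0P[e e0 eA].
    apply/(@nbhs_norm0P (Cx R) (Cx R)^o); exists (e / `|c|).
      by rewrite /= divr_gt0 // normr_gt0.
    move=> s /= se s0; apply: eA => /=; last by rewrite mulf_neq0.
    by rewrite normrM -ltr_pdivlMr // normr_gt0.
  have H : (s * c)^-1 * (expC (s * c) - 1) * c @[s --> (0 : Cx R)^'] --> 1 * c.
    exact: cvgM (cvg_comp _ _ sc (@expC_derivative0 R)) (cvg_cst c).
  rewrite -[X in _ --> X]mul1r; apply: cvg_trans H; apply: near_eq_cvg.
  rewrite near_withinE; near=> s => s0; rewrite ?fctE /=; field.
  by rewrite c0 s0.
have H' : s^-1 * (expC (s * c) - 1) * deform t z @[s --> increments Om l t] --> c * deform t z.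
  have H1 : s^-1 * (expC (s * c) - 1) @[s --> increments Om l t] --> c.
    exact: cvg_increments H.
  exact: cvgM H1 (cvg_cst _).
apply: cvg_trans H'; apply: near_eq_cvg; apply: near_increments => s s0 st.
by rewrite /diffq ?fctE /= deform_translate //; ring.
Unshelve. all: by end_near. Qed.

End Deform.

(** * The differential algebra of moments and deformation factors *)

Section Smooth.
Variables (R : realType) (v : nat -> Cx R) (Om : set (param R)).
Implicit Types (f g : param R -> Cx R) (t : param R) (l : nat).

(** An inductive closure, so that differentiability and commutation of the [theta] are proved by
    induction on the construction. [smooth_ext] is needed because identities are only available on
    [Om]. *)
Inductive smooth : (param R -> Cx R) -> Prop :=
| smooth_moment n : smooth (moment v n)
| smooth_deform z : smooth (fun t => deform t z)
| smooth_cst a : smooth (fun=> a)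
| smoothD f g : smooth f -> smooth g -> smooth (fun t => f t + g t)
| smoothM f g : smooth f -> smooth g -> smooth (fun t => f t * g t)
| smoothV f : (forall t, Om t -> f t != 0) -> smooth f -> smooth (fun t => (f t)^-1)
| smooth_ext f g : (forall t, Om t -> f t = g t) -> smooth f -> smooth g.

Lemma smoothN f : smooth f -> smooth (fun t => - f t).
Proof.
move=> sf; apply: (smooth_ext _ (smoothM (smooth_cst (-1)) sf)) => t _; exact: mulN1r.
Qed.

Lemma smoothB f g : smooth f -> smooth g -> smooth (fun t => f t - g t).
Proof. by move=> sf sg; apply: smoothD => //; exact: smoothN. Qed.

Lemma smooth_sum (I : Type) (r : seq I) (p : pred I) (F : I -> param R -> Cx R) :
  (forall i, p i -> smooth (F i)) -> smooth (fun t => \sum_(i <- r | p i) F i t).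
Proof.
move=> sF; elim: r => [|i r IH].
  by apply: (smooth_ext _ (smooth_cst 0)) => t _; rewrite big_nil.
have [pi|pi] := boolP (p i).
  by apply: (smooth_ext _ (smoothD (sF i pi) IH)) => t _; rewrite big_cons pi.
by apply: (smooth_ext _ IH) => t _; rewrite big_cons (negbTE pi).
Qed.

Lemma smooth_prod (I : Type) (r : seq I) (F : I -> param R -> Cx R) :
  (forall i, smooth (F i)) -> smooth (fun t => \prod_(i <- r) F i t).
Proof.
move=> sF; elim: r => [|i r IH].
  by apply: (smooth_ext _ (smooth_cst 1)) => t _; rewrite big_nil.
by apply: (smooth_ext _ (smoothM (sF i) IH)) => t _; rewrite big_cons.
Qed.

Lemma smooth_det n (M : param R -> 'M[Cx R]_n) :
  (forall i j, smooth (fun t => M t i j)) -> smooth (fun t => \det (M t)).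
Proof.
move=> sM; apply: smooth_sum => s _; apply: smoothM; first exact: smooth_cst.
exact: smooth_prod.
Qed.

Variable P : nat -> param R -> {poly Cx R}.
Hypothesis H : deformed_orthogonality v Om P.

(** By [is_theta_deform] at z = k, differentiating the k-th term multiplies it by k^l. The termwise
    derivative is therefore again a moment. *)
Lemma is_theta_moment n l t : Om t -> (1 <= l)%N ->
  is_theta Om l (moment v n) t (moment v (n + l) t).
Proof.
move=> tO l0; rewrite [moment v (n + l) t]/moment.
have E k : k%:R ^+ (n + l) * weight v t k =
    theta Om l (fun t' => k%:R ^+ n * weight v t' k) t.
  apply/esym/(is_theta_theta (domain_accessible H)) => //.
  have D := is_theta_deform (deform_cvg H) (z := k%:R) tO l0.
  have := is_thetaM (is_theta_cst Om l t (k%:R ^+ n))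
            (is_thetaM (is_theta_cst Om l t (v k)) D).
  rewrite /weight; congr (is_theta _ _ _ _ _); rewrite exprD; ring.
rewrite (funext E).
exact: moment_termwise H _ _ _ _ _.
Qed.

(** The derivative is exhibited as a member of the same class, which permits iteration. *)
Lemma smooth_is_theta l f : smooth f -> (1 <= l)%N ->
  exists2 g, smooth g & forall t, Om t -> is_theta Om l f t (g t).
Proof.
move=> sf l0; elim: f / sf => [n|z|a|f g sf [f' sf' df] sg [g' sg' dg]|
    f g sf [f' sf' df] sg [g' sg' dg]|f f0 sf [f' sf' df]|f g fg sf [f' sf' df]].
- by exists (moment v (n + l)); [exact: smooth_moment|move=> t tO; exact: is_theta_moment].
- exists (fun t => z ^+ l * deform t z); first exact: smoothM (smooth_cst _) (smooth_deform _).
  by move=> t tO; apply: is_theta_deform => //; exact: deform_cvg H.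
- exists (fun=> 0); first exact: smooth_cst.
  by move=> t _; exact: is_theta_cst.
- exists (fun t => f' t + g' t); first exact: smoothD.
  by move=> t tO; apply: is_thetaD; [exact: df|exact: dg].
- exists (fun t => f' t * g t + f t * g' t); first by apply: smoothD; exact: smoothM.
  by move=> t tO; apply: is_thetaM; [exact: df|exact: dg].
- exists (fun t => - (f' t * (f t ^+ 2)^-1));
    last by move=> t tO; apply: is_thetaV => //; exact: df.
  apply: smoothN; apply: smoothM => //; apply: smoothV; last exact: smoothM.
  by move=> t tO; rewrite expf_neq0 // f0.
- by exists f' => // t tO; exact: is_theta_ext (df t tO).
Qed.

Lemma smoothP l f t : smooth f -> (1 <= l)%N -> Om t -> is_theta Om l f t (theta Om l f t).
Proof.
move=> sf l0 tO; have [g _ fg] := smooth_is_theta sf l0.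
by rewrite (is_theta_theta (domain_accessible H) tO l0 (fg t tO)); exact: fg.
Qed.

Lemma smooth_theta l f : smooth f -> (1 <= l)%N -> smooth (theta Om l f).
Proof.
move=> sf l0; have [g sg fg] := smooth_is_theta sf l0.
apply: (smooth_ext _ sg) => t tO.
by rewrite (is_theta_theta (domain_accessible H) tO l0 (fg t tO)).
Qed.

(* Otherwise failed unifications unfold the limits. *)
#[local] Opaque theta moment deform.

Section ThetaRules.
Variable l : nat.
Hypothesis l0 : (1 <= l)%N.

(** Increments never leave [Om], so values elsewhere do not matter. This replaces rewriting under
    [theta] for identities that hold only on [Om]. *)
Lemma eq_theta f g t : smooth f -> (forall t', Om t' -> f t' = g t') -> Om t ->
  theta Om l f t = theta Om l g t.
Proof.
move=> sf fg tO; apply/esym/(is_theta_theta (domain_accessible H)) => //.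
apply: is_theta_ext fg _ => //; exact: smoothP.
Qed.

Lemma theta_moment n t : Om t -> theta Om l (moment v n) t = moment v (n + l) t.
Proof.
by move=> tO; apply: (is_theta_theta (domain_accessible H)) => //; exact: is_theta_moment.
Qed.

Lemma theta_deform z t : Om t ->
  theta Om l (fun t => deform t z) t = z ^+ l * deform t z.
Proof.
move=> tO; apply: (is_theta_theta (domain_accessible H)) => //.
by apply: is_theta_deform => //; exact: deform_cvg H.
Qed.

Lemma theta_cst a t : Om t -> theta Om l (fun=> a) t = 0.
Proof. by move=> tO; apply: (is_theta_theta (domain_accessible H)) => //; exact: is_theta_cst. Qed.

Lemma thetaD f g t : smooth f -> smooth g -> Om t ->
  theta Om l (fun t => f t + g t) t = theta Om l f t + theta Om l g t.
Proof.
move=> sf sg tO; apply: (is_theta_theta (domain_accessible H)) => //.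
by apply: is_thetaD; exact: smoothP.
Qed.

Lemma thetaM f g t : smooth f -> smooth g -> Om t ->
  theta Om l (fun t => f t * g t) t = theta Om l f t * g t + f t * theta Om l g t.
Proof.
move=> sf sg tO; apply: (is_theta_theta (domain_accessible H)) => //.
by apply: is_thetaM; exact: smoothP.
Qed.

Lemma thetaZ a f t : smooth f -> Om t ->
  theta Om l (fun t => a * f t) t = a * theta Om l f t.
Proof.
move=> sf tO; rewrite thetaM //; last exact: smooth_cst.
by rewrite theta_cst // mul0r add0r.
Qed.

Lemma thetaB f g t : smooth f -> smooth g -> Om t ->
  theta Om l (fun t => f t - g t) t = theta Om l f t - theta Om l g t.
Proof.
move=> sf sg tO; rewrite thetaD //; last exact: smoothN.
congr (_ + _); rewrite -mulN1r -thetaZ //; apply: eq_theta => //; first exact: smoothN.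
by move=> t' _; rewrite mulN1r.
Qed.

Lemma theta_sum (I : Type) (r : seq I) (F : I -> param R -> Cx R) t :
  (forall i, smooth (F i)) -> Om t ->
  theta Om l (fun t => \sum_(i <- r) F i t) t = \sum_(i <- r) theta Om l (F i) t.
Proof.
move=> sF tO; elim: r => [|i r IH].
  rewrite big_nil; transitivity (theta Om l (fun=> 0) t); last exact: theta_cst.
  apply: eq_theta => //; first exact: smooth_sum.
  by move=> t' _; rewrite big_nil.
rewrite big_cons -IH -thetaD //; last exact: smooth_sum.
apply: eq_theta => //; first exact: smooth_sum.
by move=> t' _; rewrite big_cons.
Qed.

End ThetaRules.

Lemma thetaM2 a b f g t : (1 <= a)%N -> (1 <= b)%N -> smooth f -> smooth g -> Om t ->
  theta Om a (theta Om b (fun t => f t * g t)) t =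
  theta Om a (theta Om b f) t * g t + theta Om b f t * theta Om a g t
  + (theta Om a f t * theta Om b g t + f t * theta Om a (theta Om b g) t).
Proof.
move=> a0 b0 sf sg tO.
have [sbf sbg] := (smooth_theta sf b0, smooth_theta sg b0).
rewrite (@eq_theta a a0 _ (fun t => theta Om b f t * g t + f t * theta Om b g t)) //; last 2 first.
- by apply: smooth_theta => //; exact: smoothM.
- by move=> t' tO'; rewrite thetaM.
by rewrite thetaD ?thetaM //; exact: smoothM.
Qed.

(** Induction on [smooth]: on a moment both orders raise the index by a + b, on [deform] both
    multiply by z^(a+b), and the rules of calculus propagate the symmetry. *)
Lemma thetaC a b f t : smooth f -> (1 <= a)%N -> (1 <= b)%N -> Om t ->
  theta Om a (theta Om b f) t = theta Om b (theta Om a f) t.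
Proof.
move=> sf a0 b0.
have eq2 c d g h t' : (1 <= c)%N -> (1 <= d)%N -> smooth g ->
    (forall t, Om t -> theta Om d g t = h t) -> Om t' ->
    theta Om c (theta Om d g) t' = theta Om c h t'.
  by move=> c0 d0 sg gh t'O; apply: eq_theta => //; exact: smooth_theta.
elim: f / sf t => [n|z|c|f g sf IHf sg IHg|f g sf IHf sg IHg|f f0 sf IHf|f g fg sf IHf] t tO.
- have E c d : (1 <= c)%N -> (1 <= d)%N ->
      theta Om c (theta Om d (moment v n)) t = moment v (n + d + c) t.
    move=> c0 d0; rewrite -theta_moment //; apply: eq2 => //; first exact: smooth_moment.
    by move=> t' t'O; exact: theta_moment.
  by rewrite !E // addnAC.
- have E c d : (1 <= c)%N -> (1 <= d)%N ->
      theta Om c (theta Om d (fun t => deform t z)) t = z ^+ d * (z ^+ c * deform t z).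
    move=> c0 d0; rewrite -theta_deform // -thetaZ //; last exact: smooth_deform.
    by apply: eq2 => //; [exact: smooth_deform|move=> t' t'O; exact: theta_deform].
  by rewrite !E //; ring.
- have E k d : (1 <= k)%N -> (1 <= d)%N -> theta Om k (theta Om d (fun=> c)) t = 0.
    move=> k0 d0; rewrite -(theta_cst k0 0 tO); apply: eq2 => //; first exact: smooth_cst.
    by move=> t' t'O; exact: theta_cst.
  by rewrite !E.
- have E c d : (1 <= c)%N -> (1 <= d)%N -> theta Om c (theta Om d (fun t => f t + g t)) t =
      theta Om c (theta Om d f) t + theta Om c (theta Om d g) t.
    move=> c0 d0; rewrite -thetaD //; try exact: smooth_theta.
    by apply: eq2 => //; [exact: smoothD|move=> t' t'O; exact: thetaD].
  by rewrite (E a b a0 b0) (E b a b0 a0) (IHf t tO) (IHg t tO).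
- rewrite (thetaM2 a0 b0 sf sg tO) (thetaM2 b0 a0 sf sg tO) (IHf t tO) (IHg t tO).
  exact: addrACA.
(* Both mixed derivatives of f f^-1 = 1 vanish. Their product expansions agree except in the term
   where f^-1 is differentiated twice, and its factor f cancels. *)
- have sV := smoothV f0 sf.
  have comm1 c d : (1 <= c)%N -> (1 <= d)%N ->
      theta Om c (theta Om d (fun t => f t * (f t)^-1)) t = 0.
    move=> c0 d0; rewrite -(theta_cst c0 0 tO); apply: eq2 => //; first exact: smoothM.
    move=> t' t'O; rewrite -(theta_cst d0 1 t'O); apply: eq_theta => //; first exact: smoothM.
    by move=> t2 t2O; rewrite divff // f0.
  have := comm1 _ _ a0 b0; rewrite -(comm1 _ _ b0 a0).
  rewrite (thetaM2 a0 b0 sf sV tO) (thetaM2 b0 a0 sf sV tO) (IHf t tO).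
  by rewrite addrACA => /addrI/addrI/(mulfI (f0 t tO)).
- have E c d : (1 <= c)%N -> (1 <= d)%N ->
      theta Om c (theta Om d f) t = theta Om c (theta Om d g) t.
    by move=> c0 d0; apply: eq2 => // t' t'O; exact: eq_theta.
  by rewrite -(E a b a0 b0) -(E b a b0 a0) (IHf t tO).
Qed.

End Smooth.

(** * Orthogonality as a linear system in the moments *)

Section Orthogonality.
Variables (R : realType) (v : nat -> Cx R) (Om : set (param R)).
Variable P : nat -> param R -> {poly Cx R}.
Hypothesis H : deformed_orthogonality v Om P.
Implicit Types (t : param R).

Lemma cvg_finite_sum (I : Type) (r : seq I) (u : I -> nat -> Cx R) (a : I -> Cx R) :
  (forall i, u i k @[k --> \oo] --> a i) ->
  \sum_(i <- r) u i k @[k --> \oo] --> \sum_(i <- r) a i.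
Proof.
move=> ua; elim: r => [|i r IH].
  by rewrite big_nil; under eq_fun do rewrite big_nil; exact: cvg_cst.
by rewrite big_cons; under eq_fun do rewrite big_cons; exact: cvgD (ua i) IH.
Qed.

Lemma lim_series_poly (q : {poly Cx R}) j t : Om t ->
  limn (series (fun k => q.[k%:R] * k%:R ^+ j * weight v t k)) =
  \sum_(i < size q) q`_i * moment v (i + j) t.
Proof.
move=> tO; apply: cvg_lim; first exact: norm_hausdorff.
have -> : series (fun k => q.[k%:R] * k%:R ^+ j * weight v t k) =
    fun N => \sum_(i < size q) q`_i * series (fun k => k%:R ^+ (i + j) * weight v t k) N.
  apply/funext => N; rewrite /series /=.
  under [RHS]eq_bigr do rewrite mulr_sumr.
  rewrite exchange_big /=; apply: eq_bigr => k _.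
  rewrite horner_coef !mulr_suml; apply: eq_bigr => i _; rewrite exprD; ring.
apply: cvg_finite_sum => i.
have h1 : series (fun k => k%:R ^+ (i + j) * weight v t k) N @[N --> \oo] --> moment v (i + j) t.
  exact: moment_cvg H _ _ tO.
exact: cvgM (cvg_cst _) h1.
Qed.

Lemma coef_lead n t : Om t -> (P n t)`_n = 1.
Proof.
by move=> tO; have [/monicP + sP] := poly_monic H n tO; rewrite /lead_coef sP.
Qed.

Lemma coef_gt n i t : Om t -> (n < i)%N -> (P n t)`_i = 0.
Proof.
by move=> tO ni; apply: nth_default; have [_ ->] := poly_monic H n tO.
Qed.

Lemma orthogonal_coef n j t : Om t -> (j < n)%N ->
  \sum_(i < n.+1) (P n t)`_i * moment v (i + j) t = 0.
Proof.
move=> tO jn; have := poly_orthogonal H tO jn.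
by rewrite lim_series_poly //; have [_ ->] := poly_monic H n tO.
Qed.

Let gram n t : 'M[Cx R]_n := \matrix_(i < n, j < n) moment v (i + j) t.

Let gram_unit n t : Om t -> gram n t \in unitmx.
Proof. by move=> tO; rewrite unitmxE unitfE; exact: minors_neq0 H _ _ tO. Qed.

(** The Gram matrix is invertible by the condition on the minors, so a polynomial of degree < n
    orthogonal to 1, ..., z^(n-1) is zero. *)
Lemma moment_unique n t (c : nat -> Cx R) : Om t ->
  (forall j, (j < n)%N -> \sum_(i < n) c i * moment v (i + j) t = 0) ->
  forall i, (i < n)%N -> c i = 0.
Proof.
move=> tO c0 i ilt.
have E : (\row_(k < n) c k) *m gram n t = 0.
  apply/rowP => j; rewrite !mxE -[RHS](c0 j (ltn_ord j)).
  by apply: eq_bigr => k _; rewrite !mxE.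
have : \row_(k < n) c k = 0 by rewrite -(mulmxK (gram_unit n tO) (\row__ _)) E mul0mx.
by move/rowP/(_ (Ordinal ilt)); rewrite !mxE.
Qed.

Lemma smooth_coef n i : smooth v Om (fun t => (P n t)`_i).
Proof.
have [ni|] := ltnP n i.
  by apply: (smooth_ext _ (smooth_cst _ _ 0)) => t tO; rewrite coef_gt.
rewrite leq_eqVlt => /predU1P[->|ilt].
  by apply: (smooth_ext _ (smooth_cst _ _ 1)) => t tO; rewrite coef_lead.
have sg k l : smooth v Om (fun t => gram n t k l).
  by apply: (smooth_ext _ (smooth_moment v Om (k + l))) => t _; rewrite mxE.
have det0 t : Om t -> \det (gram n t) != 0 by move=> tO; exact: minors_neq0 H _ _ tO.
(* Cramer's rule for the coefficients below the leading one: entry (j, i) of the inverse Gram matrix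
   is a cofactor divided by the determinant. *)
pose sol t := \sum_(j < n) - moment v (n + j) t *
  ((\det (gram n t))^-1 *
   ((-1) ^+ (Ordinal ilt + j) * \det (row' (Ordinal ilt) (col' j (gram n t))))).
apply: (smooth_ext (f := sol)); last first.
  apply: smooth_sum => j _; apply: smoothM; first by apply: smoothN; exact: smooth_moment.
  apply: smoothM; first by apply: smoothV => //; exact: smooth_det.
  apply: smoothM; first exact: smooth_cst.
  apply: smooth_det => k l.
  by apply: (smooth_ext _ (sg (lift (Ordinal ilt) k) (lift j l))) => t _; rewrite [RHS]mxE [RHS]mxE.
move=> t tO.
have E : (\row_(k < n) (P n t)`_k) *m gram n t = \row_j - moment v (n + j) t.
  apply/rowP => j; rewrite !mxE; apply/eqP; rewrite -addr_eq0; apply/eqP.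
  rewrite -[RHS](orthogonal_coef tO (ltn_ord j)) big_ord_recr /= coef_lead // mul1r.
  congr (_ + _).
  by apply: eq_bigr => k _; rewrite !mxE.
have := mulmxK (gram_unit n tO) (\row_k (P n t)`_k); rewrite E => /rowP/(_ (Ordinal ilt)).
rewrite [RHS]mxE => <-; rewrite mxE; apply: eq_bigr => j _.
by rewrite mxE /invmx gram_unit // !mxE.
Qed.

End Orthogonality.

(** * Power series in x = 1/z and unitriangular systems *)

Section Sequences.
Variable K : comNzRingType.
Implicit Types (a b c mu g : nat -> K).

(** The Cauchy product: sequences stand for the coefficients of power series in x. *)
Definition cmul a b (r : nat) : K := \sum_(i < r.+1) a i * b (r - i)%N.

(* The coefficients of x^k a. *)
Definition delay (k : nat) a (r : nat) : K := if (k <= r)%N then a (r - k)%N else 0.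

(* The linear functional z^k |-> mu k at the polynomial of degree d whose
   coefficients, from the leading one down, are a 0, a 1, ...: mu is either a
   shifted sequence of moments or the sequence z^k deform(z). *)
Definition pairing (d : nat) a mu : K := \sum_(r < d.+1) a r * mu (d - r)%N.

(** Truncation to polynomials lets commutativity and associativity be inherited from [{poly K}]. *)
Lemma cmul_coef N a b r : (r < N)%N ->
  cmul a b r = (\poly_(i < N) a i * \poly_(i < N) b i)`_r.
Proof.
move=> rN; rewrite coefM; apply: eq_bigr => i _; rewrite !coef_poly.
by rewrite (leq_ltn_trans (leq_ord i) rN) (leq_ltn_trans (leq_subr _ _) rN).
Qed.

Lemma cmulC a b r : cmul a b r = cmul b a r.
Proof. by rewrite !(cmul_coef _ _ (ltnSn r)) mulrC. Qed.

Lemma eq_cmull a a' b r : (forall i, (i <= r)%N -> a i = a' i) -> cmul a b r = cmul a' b r.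
Proof. by move=> E; apply: eq_bigr => i _; rewrite E ?leq_ord. Qed.

Lemma eq_cmulr a b b' r : (forall i, (i <= r)%N -> b i = b' i) -> cmul a b r = cmul a b' r.
Proof. by move=> E; apply: eq_bigr => i _; rewrite E ?leq_subr. Qed.

Lemma cmulA a b c r : cmul a (cmul b c) r = cmul (cmul a b) c r.
Proof.
rewrite !(cmul_coef _ _ (ltnSn r)).
have E x y : \poly_(i < r.+1) cmul x y i =
    take_poly r.+1 (\poly_(i < r.+1) x i * \poly_(i < r.+1) y i).
  by apply/polyP => i; rewrite coef_poly coef_take_poly; case: ifP => // /cmul_coef ->.
rewrite !E.
have T (p q : {poly K}) : (p * take_poly r.+1 q)`_r = (p * q)`_r.
  rewrite !coefM; apply: eq_bigr => i _; congr (_ * _).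
  by rewrite coef_take_poly ltnS leq_subr.
by rewrite T [in RHS]mulrC T mulrA mulrC.
Qed.

Lemma cmulDl a a' b r : cmul (fun i => a i + a' i) b r = cmul a b r + cmul a' b r.
Proof. by rewrite -big_split; apply: eq_bigr => i _; rewrite mulrDl. Qed.

Lemma cmulBl a a' b r : cmul (fun i => a i - a' i) b r = cmul a b r - cmul a' b r.
Proof. by rewrite -sumrB; apply: eq_bigr => i _; rewrite mulrBl. Qed.

Lemma cmul_suml N (k : nat -> K) (a : nat -> nat -> K) b r :
  cmul (fun x => \sum_(i < N) k i * a i x) b r = \sum_(i < N) k i * cmul (a i) b r.
Proof.
rewrite /cmul; under eq_bigr do rewrite mulr_suml.
rewrite exchange_big; apply: eq_bigr => i _; rewrite mulr_sumr.
by apply: eq_bigr => x _; rewrite mulrA.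
Qed.

Lemma cmul1l b r : cmul (fun i => (i == 0%N)%:R) b r = b r.
Proof.
by rewrite /cmul big_ord_recl /= mul1r subn0 big1 ?addr0 // => i _; rewrite mul0r.
Qed.

Lemma cmul_delay k a b r : cmul (delay k a) b r = delay k (cmul a b) r.
Proof.
rewrite {2}/delay /cmul; case: leqP => kr; last first.
  by apply: big1 => i _; rewrite /delay leqNgt (leq_trans (ltn_ord i) kr) mul0r.
rewrite -(big_mkord xpredT (fun i => delay k a i * b (r - i)%N)) (big_cat_nat (n := k)) //=;
  last by rewrite ltnW.
rewrite big_nat big1 ?add0r; last by move=> i /andP[_ ik]; rewrite /delay leqNgt ik mul0r.
rewrite -{1}[k]add0n big_addn subSn // big_mkord; apply: eq_bigr => i _.
by rewrite /delay leq_addl addnK subnDA subnAC.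
Qed.

(** Delaying by k while raising the degree by k leaves the polynomial unchanged. *)
Lemma pairing_delay d k a mu : pairing (d + k) (delay k a) mu = pairing d a mu.
Proof.
rewrite -[LHS]/(cmul (delay k a) mu (d + k)) cmul_delay /delay leq_addl addnK //.
Qed.

(** Raising the degree with the same coefficients multiplies the polynomial by z^k, which the
    functional sees as a shift of [mu]. *)
Lemma pairing_widen d k a mu : (forall r, (d < r)%N -> a r = 0) ->
  pairing (d + k) a mu = pairing d a (fun i => mu (i + k)%N).
Proof.
move=> a0; rewrite /pairing -(big_mkord xpredT (fun r => a r * mu (d + k - r)%N)).
rewrite (big_cat_nat (n := d.+1)) ?ltnS ?leq_addr //= [X in _ + X]big_nat [X in _ + X]big1.
  rewrite addr0 big_mkord; apply: eq_bigr => i _; congr (_ * mu _).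
  by rewrite addnC -addnBA ?leq_ord // addnC.
by move=> i /andP[di _]; rewrite a0 // mul0r.
Qed.

Fixpoint solve_seq g (A : nat -> nat -> K) N : seq K :=
  if N is N'.+1 then
    let s := solve_seq g A N' in rcons s (g N' - \sum_(i < N') s`_i * A i N')
  else [::].

(* The solution x of the unitriangular system x r + \sum_(i < r) x i * a i r = g r. *)
Definition solve g (A : nat -> nat -> K) r := (solve_seq g A r.+1)`_r.

Lemma size_solve_seq g (A : nat -> nat -> K) N : size (solve_seq g A N) = N.
Proof. by elim: N => //= N IH; rewrite size_rcons IH. Qed.

Lemma nth_solve_seq g (A : nat -> nat -> K) N r : (r < N)%N -> (solve_seq g A N)`_r = solve g A r.
Proof.
elim: N => // N IH; rewrite ltnS leq_eqVlt => /predU1P[->//|rN].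
by rewrite /= nth_rcons size_solve_seq rN IH.
Qed.

Lemma solveE g (A : nat -> nat -> K) r : solve g A r = g r - \sum_(i < r) solve g A i * A i r.
Proof.
rewrite /solve /= nth_rcons size_solve_seq ltnn eqxx; congr (_ - _).
by apply: eq_bigr => i _; rewrite nth_solve_seq.
Qed.

End Sequences.

(** * The series S, its logarithmic derivative and the coefficients u_i *)

Section Dressing.
Variables (R : realType) (v : nat -> Cx R) (Om : set (param R)).
Variable P : nat -> param R -> {poly Cx R}.
Hypothesis H : deformed_orthogonality v Om P.
Variable n : nat.
Implicit Types (t : param R).
Local Notation smooth := (smooth v Om).

(* The series S = z^-n P_n in x = 1/z. *)
Definition dress (r : nat) t : Cx R := if (r <= n)%N then (P n t)`_(n - r) else 0.

(* The coefficients of (theta_1 + z)^j P_n, from the leading one down. *)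
Fixpoint Dwave (j r : nat) t : Cx R :=
  if j is j'.+1 then Dwave j' r t + delay 1 (fun r' => theta Om 1 (Dwave j' r') t) r
  else dress r t.

(* The logarithmic derivative h = (theta_1 S) / S. *)
Definition dlog (r : nat) t : Cx R :=
  solve (fun r => theta Om 1 (dress r) t) (fun i r => dress (r - i) t) r.

(* The series F_j in x = 1/z such that (theta_1 + z)^j P_n = z^j F_j P_n. *)
Fixpoint Dquot (j r : nat) t : Cx R :=
  if j is j'.+1 then
    Dquot j' r t + delay 1 (fun r' => theta Om 1 (Dquot j' r') t
                                      + cmul (dlog^~ t) (Dquot j'^~ t) r') r
  else (r == 0%N)%:R.

(* The u_i that make remainder vanish up to order m; only i <= m is meaningful. *)
Definition ucoef (m r : nat) t : Cx R :=
  solve (fun r => (r == 0%N)%:R - Dquot m r t) (fun i r => Dquot (m - i) (r - i) t) r.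

Lemma smooth_delay k (A : nat -> param R -> Cx R) r :
  (forall i, smooth (A i)) -> smooth (fun t => delay k (A^~ t) r).
Proof. by rewrite /delay; case: (k <= r)%N => // _; exact: smooth_cst. Qed.

Lemma smooth_cmul (A B : nat -> param R -> Cx R) r :
  (forall i, smooth (A i)) -> (forall i, smooth (B i)) ->
  smooth (fun t => cmul (A^~ t) (B^~ t) r).
Proof. by move=> sA sB; apply: smooth_sum => i _; exact: smoothM. Qed.

Lemma smooth_dress r : smooth (dress r).
Proof.
by rewrite /dress; case: (r <= n)%N; [exact: smooth_coef H _ _|exact: smooth_cst].
Qed.

Lemma dress0 t : Om t -> dress 0 t = 1.
Proof. by move=> tO; rewrite /dress subn0 (coef_lead H). Qed.

Lemma dress1 : dress 1 = p1 P n.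
Proof. by rewrite /dress /p1; case: n => // k; rewrite subn1. Qed.

Lemma dress_gt r t : (n < r)%N -> dress r t = 0.
Proof. by rewrite /dress => nr; rewrite leqNgt nr. Qed.

Lemma smooth_Dwave j r : smooth (Dwave j r).
Proof.
elim: j r => [|j IH] r /=; first exact: smooth_dress.
apply: smoothD => //; apply: (@smooth_delay 1 (fun r' => theta Om 1 (Dwave j r')) r) => i.
exact: (smooth_theta H).
Qed.

Lemma Dwave_gt j r t : Om t -> (n + j < r)%N -> Dwave j r t = 0.
Proof.
elim: j r t => [|j IH] r t tO /=; first by rewrite addn0; exact: dress_gt.
rewrite addnS => jr; rewrite IH ?add0r //; last by rewrite ltnW.
rewrite /delay; case: r jr => // r jr; rewrite subn1 /= -[RHS](theta_cst H (ltn0Sn 0) 0 tO).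
apply: (eq_theta H) => //; first exact: smooth_Dwave.
by move=> t' tO'; rewrite IH.
Qed.

Lemma cmul_dlog r t : Om t ->
  cmul (dlog^~ t) (dress^~ t) r = theta Om 1 (dress r) t.
Proof.
by move=> tO; rewrite /cmul big_ord_recr /= subnn dress0 // mulr1 /dlog solveE addrC subrK.
Qed.

Lemma smooth_dlog r : smooth (dlog r).
Proof.
elim: r {-2}r (leqnn r) => [|N IH] r rN; (apply: (smooth_ext (f := fun t =>
    theta Om 1 (dress r) t - \sum_(i < r) dlog i t * dress (r - i) t));
  first by (move=> t _; rewrite [RHS]solveE)).
all: apply: smoothB; first exact: (smooth_theta H) (smooth_dress _) _.
all: apply: smooth_sum => i _; apply: smoothM; last exact: smooth_dress.
  by case: i; move: rN; rewrite leqn0 => /eqP ->.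
by apply: IH; rewrite -ltnS (leq_trans (ltn_ord i)).
Qed.

Lemma smooth_Dquot j r : smooth (Dquot j r).
Proof.
elim: j r => [|j IH] r /=; first exact: smooth_cst.
apply: smoothD => //; apply: (@smooth_delay 1 (fun r' t => theta Om 1 (Dquot j r') t +
  cmul (dlog^~ t) (Dquot j^~ t) r') r) => i.
by apply: smoothD; [exact: (smooth_theta H)|apply: smooth_cmul => // k; exact: smooth_dlog].
Qed.

(** By the product rule theta_1 (F_j S) = (theta_1 F_j + h F_j) S, which is the recursion defining
    [Dquot]. *)
Lemma Dwave_cmul j r t : Om t -> Dwave j r t = cmul (Dquot j^~ t) (dress^~ t) r.
Proof.
elim: j r t => [|j IH] r t tO /=; first by rewrite cmul1l.
rewrite cmulDl -IH // cmul_delay; congr (_ + _); rewrite /delay; case: ifP => // _.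
rewrite cmulDl (eq_theta H (ltn0Sn 0) (smooth_Dwave _ _) (IH (r - 1)%N) tO).
rewrite (theta_sum H (ltn0Sn 0)) //; last first.
  by move=> i; apply: smoothM; [exact: smooth_Dquot|exact: smooth_dress].
under eq_bigr => i _ do rewrite (thetaM H (ltn0Sn 0) (smooth_Dquot _ _) (smooth_dress _) tO).
rewrite big_split /=; congr (_ + _).
rewrite -[LHS]/(cmul (Dquot j^~ t) (fun r => theta Om 1 (dress r) t) (r - 1)).
rewrite -(eq_cmulr _ (fun i _ => cmul_dlog i tO)) cmulA.
by apply: eq_cmull => i _; exact: cmulC.
Qed.

Lemma Dquot0 j t : Dquot j 0 t = 1.
Proof. by elim: j => //= j ->; rewrite addr0. Qed.

(* (z^m P - (theta_1 + z)^m P - sum_i u_i (theta_1 + z)^(m-i) P) / (z^m P). *)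
Definition remainder (m r : nat) t : Cx R :=
  (r == 0%N)%:R - Dquot m r t
  - \sum_(i < m.+1) ucoef m i t * delay i (Dquot (m - i)^~ t) r.

(** Order r involves only u_0, ..., u_r, and u_r enters with the factor [Dquot (m - r) 0] = 1; this
    is the triangular system that [ucoef] solves. *)
Lemma remainder_eq0 m r t : (r <= m)%N -> remainder m r t = 0.
Proof.
move=> rm; apply/eqP; rewrite subr_eq0; apply/eqP.
rewrite -(big_mkord xpredT (fun i => ucoef m i t * delay i (Dquot (m - i)^~ t) r)).
rewrite (big_cat_nat (n := r.+1)) //=
  [X in _ = _ + X]big_nat [X in _ = _ + X]big1 ?addr0; last first.
  by move=> i /andP[ri _]; rewrite /delay leqNgt ri mulr0.
rewrite big_mkord big_ord_recr /= {2}/delay leqnn subnn Dquot0 mulr1 /ucoef solveE.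
rewrite addrC; apply/eqP; rewrite -subr_eq; apply/eqP; congr (_ - _).
by apply: eq_bigr => i _; rewrite /delay ltnW.
Qed.

(** The coefficients, from degree n + m down, of theta_m P + z^m P - (theta_1 + z)^m P - sum_i u_i
    (theta_1 + z)^(m-i) P. The delays align polynomials of different nominal degrees. *)
Definition residual (m r : nat) t : Cx R :=
  delay m (fun r' => theta Om m (dress r') t) r + dress r t - Dwave m r t
  - \sum_(i < m.+1) ucoef m i t * delay i (Dwave (m - i)^~ t) r.

Lemma residual_cmul m r t : Om t -> residual m r t =
  delay m (fun r' => theta Om m (dress r') t) r + cmul (remainder m^~ t) (dress^~ t) r.
Proof.
move=> tO; rewrite /residual /remainder 2!cmulBl cmul1l.
rewrite (cmul_suml m.+1 (fun i => ucoef m i t) (fun i => delay i (Dquot (m - i)^~ t))).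
rewrite -Dwave_cmul //.
rewrite -!addrA; congr (_ + (_ + (_ - _))); apply: eq_bigr => i _; congr (_ * _).
rewrite cmul_delay /delay; case: ifP => // _; exact: Dwave_cmul.
Qed.

(** By the product rule, differentiating [M] multiplies the polynomial by z^l and differentiating
    [A] acts on its coefficients. Thus theta_l of a pairing is the pairing with (theta_l + z^l)
    applied to the polynomial. *)
Lemma theta_pairing d l (A M : nat -> param R -> Cx R) t : (1 <= l)%N ->
  (forall r, smooth (A r)) -> (forall k, smooth (M k)) -> Om t ->
  (forall k, theta Om l (M k) t = M (k + l)%N t) ->
  (forall r, (d < r)%N -> A r t = 0) ->
  theta Om l (fun t' => pairing d (A^~ t') (M^~ t')) t =
  pairing (d + l) (fun r => A r t + delay l (fun r' => theta Om l (A r') t) r) (M^~ t).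
Proof.
move=> l0 sA sM tO thM A0.
rewrite (theta_sum H l0) //; last by move=> i; exact: smoothM.
under eq_bigr => i _ do rewrite (thetaM H l0 (sA _) (sM _) tO) thM.
rewrite big_split /= addrC -/(pairing d (A^~ t) (fun k => M (k + l)%N t)).
rewrite -/(pairing d (fun r => theta Om l (A r) t) (M^~ t)).
rewrite -(pairing_widen l (M^~ t) A0) -(pairing_delay d l).
by rewrite -big_split; apply: eq_bigr => i _; rewrite mulrDl.
Qed.

End Dressing.

#[local] Opaque theta moment deform.

(** * Vanishing of the residual and the linear equations for the wave function *)

Section Flow.
Variables (R : realType) (v : nat -> Cx R) (Om : set (param R)).
Variable P : nat -> param R -> {poly Cx R}.
Hypothesis H : deformed_orthogonality v Om P.
Variable n : nat.
Implicit Types (t : param R) (z : Cx R).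
Local Notation smooth := (smooth v Om).
Local Notation dress := (dress P n).
Local Notation Dwave := (Dwave Om P n).
Local Notation Dquot := (Dquot Om P n).
Local Notation dlog := (dlog Om P n).
Local Notation ucoef := (ucoef Om P n).
Local Notation remainder := (remainder Om P n).
Local Notation residual := (residual Om P n).

(** The coefficients of theta_m P + z^m P, from degree n + m down. *)
Definition flow m r t := dress r t + delay m (fun r' => theta Om m (dress r') t) r.

Lemma pairing_rev (K : comNzRingType) d (a mu : nat -> K) :
  pairing d a mu = \sum_(k < d.+1) a (d - k)%N * mu k.
Proof.
rewrite /pairing (reindex_inj rev_ord_inj); apply: eq_bigr => i _ /=.
by rewrite subSS subKn // -ltnS ltn_ord.
Qed.

Lemma flow_gt m r t : (1 <= m)%N -> Om t -> (n + m < r)%N -> flow m r t = 0.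
Proof.
move=> m0 tO nr; rewrite /flow dress_gt ?(leq_ltn_trans (leq_addr m n)) // add0r /delay.
case: ifP => // _; rewrite -[RHS](theta_cst H m0 0 tO); apply: (eq_theta H m0) => //.
  exact: (smooth_dress H).
by move=> t' _; rewrite dress_gt // ltn_subRL addnC.
Qed.

Lemma residual_gt m r t : (1 <= m)%N -> Om t -> (n + m < r)%N -> residual m r t = 0.
Proof.
move=> m0 tO nr; rewrite /residual [delay m _ r + _]addrC -/(flow m r t) flow_gt //.
rewrite (Dwave_gt H) // !sub0r big1 ?oppr0 ?addr0 // => i _.
rewrite /delay; case: ifP => [ir|_]; last by rewrite mulr0.
rewrite (Dwave_gt H) ?mulr0 // ltn_subRL addnC -addnA.
by rewrite subnK // -ltnS.
Qed.

Lemma residual_le m r t : (1 <= m)%N -> Om t -> (r <= m)%N -> residual m r t = 0.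
Proof.
move=> m0 tO rm; rewrite (residual_cmul H) //.
rewrite [cmul _ _ _]big1 ?addr0; last first.
  by move=> i _; rewrite remainder_eq0 ?mul0r // (leq_trans _ rm) // leq_ord.
(* At r = m what is left is theta_m of the leading coefficient 1, so the residual has degree
   strictly below n. *)
rewrite /delay; case: ifP => // mr; have -> : (r - m = 0)%N by apply/eqP; rewrite subn_eq0.
rewrite -[RHS](theta_cst H m0 1 tO); apply: (eq_theta H m0) => //.
  exact: (smooth_dress H).
by move=> t' tO'; exact: (dress0 H).
Qed.

Section Pairings.
Variable M : nat -> param R -> Cx R.
Hypothesis sM : forall k, smooth (M k).
Hypothesis tM : forall l k t, (1 <= l)%N -> Om t -> theta Om l (M k) t = M (k + l)%N t.

(** [M] will be the shifted moments, for orthogonality, or z^k [deform], for the wave function; [tM]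
    is all they need to share. *)
Lemma pairing_Dwave k t : Om t ->
  theta_eta Om k (fun t' => pairing n (dress^~ t') (M^~ t')) t =
  pairing (n + k) (Dwave k^~ t) (M^~ t).
Proof.
elim: k t => [|k IH] t tO; first by rewrite addn0.
have sD : smooth (fun t' => pairing (n + k) (Dwave k^~ t') (M^~ t')).
  by apply: smooth_sum => i _; apply: smoothM => //; exact: (smooth_Dwave H).
rewrite /theta_eta iterS -(eq_theta H (ltn0Sn 0) sD) //; last by move=> t' tO'; exact/esym/IH.
have -> : (n + k.+1 = n + k + 1)%N by rewrite addnS addn1.
rewrite (theta_pairing H) //; first exact: (smooth_Dwave H).
- by move=> j; exact: tM.
- by move=> r nr; exact: (Dwave_gt H).
Qed.

Lemma pairing_flow m t : (1 <= m)%N -> Om t ->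
  theta Om m (fun t' => pairing n (dress^~ t') (M^~ t')) t = pairing (n + m) (flow m^~ t) (M^~ t).
Proof.
move=> m0 tO; rewrite (theta_pairing H) //; first exact: (smooth_dress H).
- by move=> j; exact: tM.
- by move=> r nr; exact: dress_gt.
Qed.

Lemma pairing_residual m t :
  pairing (n + m) (residual m^~ t) (M^~ t) =
  pairing (n + m) (flow m^~ t) (M^~ t) - pairing (n + m) (Dwave m^~ t) (M^~ t)
  - \sum_(i < m.+1) ucoef m i t * pairing (n + (m - i)) (Dwave (m - i)^~ t) (M^~ t).
Proof.
have -> : \sum_(i < m.+1) ucoef m i t * pairing (n + (m - i)) (Dwave (m - i)^~ t) (M^~ t) =
    pairing (n + m) (fun r => \sum_(i < m.+1) ucoef m i t * delay i (Dwave (m - i)^~ t) r) (M^~ t).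
  rewrite [RHS](cmul_suml m.+1 (fun i => ucoef m i t) (fun i => delay i (Dwave (m - i)^~ t))).
  apply: eq_bigr => i _; congr (_ * _).
  by rewrite -(pairing_delay _ i) -addnA subnK // -ltnS.
rewrite -!cmulBl; apply: eq_bigr => i _; congr (_ * _).
by rewrite /residual /flow [delay m _ i + _]addrC.
Qed.

End Pairings.

Lemma pairing_dress_moment j t : (j < n)%N -> Om t ->
  pairing n (dress^~ t) (fun k => moment v (k + j) t) = 0.
Proof.
move=> jn tO; rewrite pairing_rev -[RHS](orthogonal_coef H tO jn).
by apply: eq_bigr => i _; rewrite /dress leq_subr subKn // -ltnS.
Qed.

(** Degrees at least n vanish by the choice of the u_i, and indices beyond n + m by the degree
    bound. The rest is a polynomial of degree < n orthogonal to 1, ..., z^(n-1), hence zero. *)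
Theorem residual_eq0 m r t : (1 <= m)%N -> Om t -> residual m r t = 0.
Proof.
move=> m0 tO; have [rm|mr] := leqP r m; first exact: residual_le.
have [nr|rn] := ltnP (n + m) r; first exact: residual_gt.
suff: forall k, (k < n)%N -> residual m (n + m - k) t = 0.
  by move=> /(_ (n + m - r)%N); rewrite subKn // => -> //; rewrite ltn_subLR // addnC ltn_add2r.
apply: (moment_unique H (t := t)) => // j jn.
pose M k t' := moment v (k + j) t'.
have sM k : smooth (M k) by exact: smooth_moment.
have tM l k t' : (1 <= l)%N -> Om t' -> theta Om l (M k) t' = M (k + l)%N t'.
  by move=> l0 tO'; rewrite /M (theta_moment H) // addnAC.
have E0 t' : Om t' -> pairing n (dress^~ t') (M^~ t') = 0.
  by move=> tO'; exact: pairing_dress_moment.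
have s0 : smooth (fun t' => pairing n (dress^~ t') (M^~ t')).
  by apply: smooth_sum => i _; apply: smoothM => //; exact: (smooth_dress H).
(* The pairing of P with z^j vanishes identically on [Om], hence so do its iterated derivatives. *)
have D0 k t' : Om t' -> pairing (n + k) (Dwave k^~ t') (M^~ t') = 0.
  move=> tO'; rewrite -(pairing_Dwave sM tM) //.
  elim: k t' tO' => [|k IH] t' tO'; first exact: E0.
  rewrite /theta_eta iterS -[RHS](theta_cst H (ltn0Sn 0) 0 tO').
  apply/esym/(eq_theta H) => //; first exact: smooth_cst.
  by move=> t2 tO2; rewrite -[RHS]/(theta_eta Om k _ t2) IH.
have := pairing_residual M m t.
rewrite D0 // -(pairing_flow sM tM) // subr0 [X in _ - X]big1 ?subr0; last first.
  by move=> i _; rewrite D0 // mulr0.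
rewrite -(eq_theta H m0 (smooth_cst v Om 0)) ?(theta_cst H) //; last by move=> *; rewrite E0.
(* The sum now runs over the degree k; terms with k >= n have index at most m and drop out. *)
rewrite pairing_rev -(big_mkord xpredT (fun k => residual m (n + m - k) t * M k t)).
rewrite (big_cat_nat (n := n)) //=; last by rewrite leqW // leq_addr.
rewrite [X in _ + X]big_nat [X in _ + X]big1 ?addr0 ?big_mkord //.
move=> k /andP[nk _]; rewrite residual_le ?mul0r //.
by rewrite leq_subLR leq_add2r.
Qed.

Let E z k t : Cx R := z ^+ k * deform t z.

Let smoothE z k : smooth (E z k).
Proof. by apply: smoothM; [exact: smooth_cst|exact: smooth_deform]. Qed.

Let thetaE z l k t : (1 <= l)%N -> Om t -> theta Om l (E z k) t = E z (k + l)%N t.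
Proof.
move=> l0 tO; rewrite (thetaZ H l0 _ (smooth_deform v Om z)) //.
by rewrite (theta_deform H) // mulrA -exprD.
Qed.

Lemma wave_pairing z t : Om t -> wave P n z t = pairing n (dress^~ t) (E z^~ t).
Proof.
move=> tO; rewrite /wave horner_coef pairing_rev; have [_ ->] := poly_monic H n tO.
rewrite mulr_suml; apply: eq_bigr => i _.
rewrite /dress leq_subr subKn; last by rewrite -ltnS.
exact/esym/mulrA.
Qed.

Lemma smooth_wave z : smooth (wave P n z).
Proof.
apply: (smooth_ext (f := fun t => pairing n (dress^~ t) (E z^~ t))).
  by move=> t tO; rewrite wave_pairing.
by apply: smooth_sum => i _; apply: smoothM => //; exact: (smooth_dress H).
Qed.

Lemma smooth_theta_eta k f : smooth f -> smooth (theta_eta Om k f).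
Proof.
move=> sf; elim: k => [//|k IH]; rewrite /theta_eta iterS.
exact: (smooth_theta H IH).
Qed.

Lemma theta_eta_ext k f g t : smooth f -> (forall t', Om t' -> f t' = g t') -> Om t ->
  theta_eta Om k f t = theta_eta Om k g t.
Proof.
move=> sf fg; elim: k t => [|k IH] t tO; first exact: fg.
rewrite /theta_eta !iterS; apply: (eq_theta H (ltn0Sn 0) _ _ tO).
  exact: smooth_theta_eta.
by move=> t' t'O; exact: IH.
Qed.

(** The vanishing residual is paired with z^k [deform], which turns theta_1 + z on P into theta_1 on
    the wave function. *)
Theorem wave_flow m z t : (1 <= m)%N -> Om t ->
  theta Om m (wave P n z) t = theta_eta Om m (wave P n z) t +
  \sum_(i < m.+1) ucoef m i t * theta_eta Om (m - i) (wave P n z) t.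
Proof.
move=> m0 tO.
have W k : theta_eta Om k (wave P n z) t = pairing (n + k) (Dwave k^~ t) (E z^~ t).
  rewrite -(pairing_Dwave (smoothE z)) //; last by move=> *; exact: thetaE.
  by apply: theta_eta_ext => //; [exact: smooth_wave|move=> t'; exact: wave_pairing].
rewrite (eq_theta H m0 (smooth_wave z) (wave_pairing z)) //.
rewrite (pairing_flow (smoothE z)) //; last by move=> *; exact: thetaE.
rewrite W; under eq_bigr do rewrite W.
apply/eqP; rewrite -subr_eq0 opprD addrA; apply/eqP.
rewrite -pairing_residual; apply: big1 => i _.
by rewrite residual_eq0 // mul0r.
Qed.

Lemma theta_dress m r t : (1 <= m)%N -> Om t ->
  theta Om m (dress r) t = - cmul (remainder m^~ t) (dress^~ t) (r + m).
Proof.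
move=> m0 tO; have := residual_eq0 (r + m) m0 tO.
by rewrite (residual_cmul H) // /delay leq_addl addnK => /eqP; rewrite addr_eq0 => /eqP.
Qed.

(** This is the case r = 1 of [theta_dress]: the remainder starts at order m + 1 and S starts with
    1, so one coefficient of the remainder survives. *)
Lemma theta_p1 m t : (1 <= m)%N -> Om t ->
  theta Om m (p1 P n) t = Dquot m m.+1 t + \sum_(i < m.+1) ucoef m i t * Dquot (m - i) (m.+1 - i) t.
Proof.
move=> m0 tO; rewrite -dress1 theta_dress // add1n /cmul big_ord_recr /= subnn (dress0 H) // mulr1.
rewrite big1 ?add0r; last by move=> i _; rewrite remainder_eq0 ?mul0r // -ltnS.
rewrite /remainder sub0r opprD !opprK; congr (_ + _); apply: eq_bigr => i _.
by rewrite /delay ltnW.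
Qed.

End Flow.

(** * The first coefficients of h, F_j and u *)

Section SmallCoefficients.
Variables (R : realType) (v : nat -> Cx R) (Om : set (param R)).
Variable P : nat -> param R -> {poly Cx R}.
Hypothesis H : deformed_orthogonality v Om P.
Variable n : nat.
Implicit Types (t : param R).
Local Notation Dquot := (Dquot Om P n).
Local Notation dlog := (dlog Om P n).
Local Notation ucoef := (ucoef Om P n).

Lemma dlog0 t : Om t -> dlog 0 t = 0.
Proof.
move=> tO; rewrite /dlog solveE big_ord0 subr0 -[RHS](theta_cst H (ltn0Sn 0) 1 tO).
by apply: (eq_theta H) => //; [exact: (smooth_dress H)|exact: (dress0 H)].
Qed.

Lemma dlog1 t : Om t -> dlog 1 t = theta Om 1 (p1 P n) t.
Proof.
move=> tO; rewrite /dlog solveE big_ord1 -/(dlog 0 t) dlog0 // mul0r subr0.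
by rewrite dress1.
Qed.

Lemma DquotS j r t : Dquot j.+1 r.+1 t =
  Dquot j r.+1 t + (theta Om 1 (Dquot j r) t + \sum_(i < r.+1) dlog i t * Dquot j (r - i) t).
Proof. by rewrite /= /delay subn1. Qed.

Lemma Dquot1 j t : Om t -> Dquot j 1 t = 0.
Proof.
move=> tO; elim: j => [//|j IH].
rewrite DquotS IH add0r big_ord1 dlog0 // mul0r addr0 -[RHS](theta_cst H (ltn0Sn 0) 1 tO).
by apply: (eq_theta H) => //; [exact: (smooth_Dquot H)|move=> t' _; exact: Dquot0].
Qed.

Lemma theta_Dquot1 j t : Om t -> theta Om 1 (Dquot j 1) t = 0.
Proof.
move=> tO; rewrite -[RHS](theta_cst H (ltn0Sn 0) 0 tO); apply: (eq_theta H) => //.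
  exact: (smooth_Dquot H).
by move=> t'; exact: Dquot1.
Qed.

Lemma Dquot2 j t : Om t -> Dquot j 2 t = j%:R * dlog 1 t.
Proof.
move=> tO; elim: j => [|j IH]; first by rewrite mul0r.
rewrite DquotS IH theta_Dquot1 // big_ord_recl big_ord1 /= dlog0 // mul0r !add0r.
by rewrite Dquot0 mulr1 -natr1 mulrDl mul1r.
Qed.

Lemma ucoef0 m t : ucoef m 0 t = 0.
Proof. by rewrite /ucoef solveE big_ord0 subr0 Dquot0 subrr. Qed.

Lemma ucoef1 m t : Om t -> ucoef m 1 t = 0.
Proof.
move=> tO; rewrite /ucoef solveE big_ord1 -/(ucoef m 0 t) ucoef0 mul0r subr0.
by rewrite Dquot1 // subr0.
Qed.

(** The source of the coefficient of theta_1^(m-2) in the wave equation. *)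
Lemma ucoef2 m t : Om t -> ucoef m 2 t = - (m%:R * theta Om 1 (p1 P n) t).
Proof.
move=> tO; rewrite /ucoef solveE big_ord_recl big_ord1 /= -/(ucoef m 0 t) -/(ucoef m 1 t).
by rewrite ucoef0 ucoef1 // !mul0r addr0 subr0 Dquot2 // dlog1 // sub0r.
Qed.

End SmallCoefficients.

(* The coefficients are treated as families indexed by all the orthogonality data
   at once, so that one polynomial expression serves every instance. *)
Record context (R : realType) := Context {
  ctx_v : nat -> Cx R;
  ctx_dom : set (param R);
  ctx_poly : nat -> param R -> {poly Cx R};
  ctx_deg : nat;
  ctx_orth : deformed_orthogonality ctx_v ctx_dom ctx_poly }.

(** * The u_i as universal polynomials in the jets of p^1 *)

Section JetPolynomials.
Variable R : realType.
Implicit Types (c : context R) (t : param R) (F G : context R -> param R -> Cx R).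

Definition jet c (ab : nat * nat) : param R -> Cx R :=
  theta_eta (ctx_dom c) ab.1 (theta (ctx_dom c) ab.2 (p1 (ctx_poly c) (ctx_deg c))).

(** A predicate leaves the order a unbounded, so closure under theta_1, which raises a, is a plain
    induction. *)
Inductive jet_poly (m : nat) : (context R -> param R -> Cx R) -> Prop :=
| jet_poly_var ab : (1 <= ab.2 < m)%N -> jet_poly m (fun c => jet c ab)
| jet_poly_cst a : jet_poly m (fun _ _ => a)
| jet_polyD F G : jet_poly m F -> jet_poly m G -> jet_poly m (fun c t => F c t + G c t)
| jet_polyM F G : jet_poly m F -> jet_poly m G -> jet_poly m (fun c t => F c t * G c t)
| jet_poly_ext F G : (forall c t, ctx_dom c t -> F c t = G c t) -> jet_poly m F -> jet_poly m G.

Lemma jet_poly_mono m m' F : (m <= m')%N -> jet_poly m F -> jet_poly m' F.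
Proof.
move=> mm; elim=> [ab /andP[b1 bm]|a|{}F G _ IF _ IG|{}F G _ IF _ IG|{}F G FG _ IF].
- by apply: jet_poly_var; rewrite b1 (leq_trans bm mm).
- exact: jet_poly_cst.
- exact: jet_polyD.
- exact: jet_polyM.
- exact: jet_poly_ext FG IF.
Qed.

Lemma jet_polyB m F G : jet_poly m F -> jet_poly m G -> jet_poly m (fun c t => F c t - G c t).
Proof.
move=> jF jG; apply: jet_polyD => //.
apply: (jet_poly_ext _ (jet_polyM (jet_poly_cst m (-1)) jG)) => c t _; exact: mulN1r.
Qed.

Lemma jet_poly_sum m N (F : nat -> context R -> param R -> Cx R) :
  (forall i, (i < N)%N -> jet_poly m (F i)) ->
  jet_poly m (fun c t => \sum_(i < N) F i c t).
Proof.
elim: N => [|N IH] jF.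
  by apply: (jet_poly_ext _ (jet_poly_cst m 0)) => c t _; rewrite big_ord0.
have h1 : jet_poly m (fun c t => \sum_(i < N) F i c t).
  by apply: IH => i iN; apply: jF; rewrite ltnW.
apply: (jet_poly_ext _ (jet_polyD h1 (jF N (ltnSn N)))) => c t _.
by rewrite big_ord_recr.
Qed.

Lemma smooth_p1 c : smooth (ctx_v c) (ctx_dom c) (p1 (ctx_poly c) (ctx_deg c)).
Proof. by rewrite -dress1; exact: (smooth_dress (ctx_orth c)). Qed.

Lemma jet_poly_smooth m F c : jet_poly m F -> smooth (ctx_v c) (ctx_dom c) (F c).
Proof.
elim=> [ab /andP[b1 bm]|a|{}F G _ IF _ IG|{}F G _ IF _ IG|{}F G FG _ IF].
- apply: (smooth_theta_eta (ctx_orth c)); apply: (smooth_theta (ctx_orth c)) => //.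
  exact: smooth_p1.
- exact: smooth_cst.
- exact: smoothD.
- exact: smoothM.
- by apply: smooth_ext IF => t; exact: FG.
Qed.

Lemma jet_poly_theta m F : jet_poly m F -> jet_poly m (fun c => theta (ctx_dom c) 1 (F c)).
Proof.
have l0 := ltn0Sn 0.
elim=> [[a b] abm|a|{}F G jF IF jG IG|{}F G jF IF jG IG|{}F G FG jF IF].
- exact: (jet_poly_var (ab := (a.+1, b))).
- apply: (jet_poly_ext _ (jet_poly_cst m 0)) => c t tO.
  by rewrite (theta_cst (ctx_orth c)).
- apply: (jet_poly_ext _ (jet_polyD IF IG)) => c t tO.
  by rewrite (thetaD (ctx_orth c) l0 (jet_poly_smooth c jF) (jet_poly_smooth c jG)).
- apply: (jet_poly_ext _ (jet_polyD (jet_polyM IF jG) (jet_polyM jF IG))) => c t tO.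
  by rewrite (thetaM (ctx_orth c) l0 (jet_poly_smooth c jF) (jet_poly_smooth c jG)).
- apply: (jet_poly_ext _ IF) => c t tO.
  exact: (eq_theta (ctx_orth c) l0 (jet_poly_smooth c jF) (FG c) tO).
Qed.

Let Dq j r c := Dquot (ctx_dom c) (ctx_poly c) (ctx_deg c) j r.
Let h r c := dlog (ctx_dom c) (ctx_poly c) (ctx_deg c) r.
Let u m r c := ucoef (ctx_dom c) (ctx_poly c) (ctx_deg c) m r.

Section Step.
Variables m M : nat.
Hypothesis jh : forall b, (b < M)%N -> jet_poly m (h b).

(** The factor x in the recursion for F_j makes order r depend only on h_b with b < r, so r = [M] is
    still allowed. *)
Lemma jet_poly_Dquot j r : (r <= M)%N -> jet_poly m (Dq j r).
Proof.
elim: j r => [|j IH] r rM; first exact: jet_poly_cst.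
case: r rM => [|r] rM.
  by apply: (jet_poly_ext _ (jet_poly_cst m 1)) => c t _; rewrite /Dq Dquot0.
have js : jet_poly m (fun c t => \sum_(i < r.+1) h i c t * Dq j (r - i) c t).
  apply: (@jet_poly_sum m r.+1 (fun i c t => h i c t * Dq j (r - i) c t)) => i ir.
  apply: jet_polyM; first by apply: jh; exact: leq_trans ir rM.
  by apply: IH; rewrite (leq_trans (leq_subr _ _)) // ltnW.
have := jet_polyD (IH _ rM) (jet_polyD (jet_poly_theta (IH _ (ltnW rM))) js).
by apply: jet_poly_ext => c t _; rewrite /Dq DquotS.
Qed.

(** Order [M] + 1 is the first to contain h_M; each of the j steps of the recursion adds it once,
    multiplied by the leading coefficient 1. *)
Lemma jet_poly_Dquot_top j :
  jet_poly m (fun c t => Dq j M.+1 c t - j%:R * h M c t).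
Proof.
elim: j => [|j IH].
  by apply: (jet_poly_ext _ (jet_poly_cst m 0)) => c t _; rewrite mul0r subr0.
have js : jet_poly m (fun c t => \sum_(i < M) h i c t * Dq j (M - i) c t).
  apply: (@jet_poly_sum m M (fun i c t => h i c t * Dq j (M - i) c t)) => i iM.
  by apply: jet_polyM; [exact: jh|apply: jet_poly_Dquot; exact: leq_subr].
have := jet_polyD IH (jet_polyD (jet_poly_theta (jet_poly_Dquot j (leqnn M))) js).
apply: jet_poly_ext => c t _; rewrite /Dq DquotS big_ord_recr /= subnn Dquot0 mulr1.
rewrite -/(h M c t) -natr1; ring.
Qed.

Lemma jet_poly_ucoef k r : (r <= M)%N -> jet_poly m (u k r).
Proof.
elim/ltn_ind: r => r IH rM.
have js : jet_poly m (fun c t => \sum_(i < r) u k i c t * Dq (k - i) (r - i) c t).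
  apply: (@jet_poly_sum m r (fun i c t => u k i c t * Dq (k - i) (r - i) c t)) => i ir.
  apply: jet_polyM; first by apply: IH => //; rewrite ltnW // (leq_trans ir).
  by apply: jet_poly_Dquot; rewrite (leq_trans (leq_subr _ _)).
have := jet_polyB (jet_polyB (jet_poly_cst m (r == 0%N)%:R) (jet_poly_Dquot k rM)) js.
by apply: jet_poly_ext => c t _; rewrite [RHS]/u /ucoef solveE.
Qed.

End Step.

(** Induction on m: [theta_p1] is solved for h_m, dividing by m. The variable theta_m p^1 this
    introduces is admissible from the bound m + 1 on. *)
Lemma jet_poly_dlog m b : (b < m)%N -> jet_poly m (h b).
Proof.
elim: m b => [//|m IH] b.
have jh i : (i < m)%N -> jet_poly m.+1 (h i).
  by move=> im; apply: jet_poly_mono (IH i im); exact: leqnSn.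
rewrite ltnS leq_eqVlt => /predU1P[->|]; last exact: jh.
have [m0|m0] := posnP m.
  rewrite m0; apply: (jet_poly_ext _ (jet_poly_cst 1 0)) => c t tO.
  by rewrite /h (dlog0 (ctx_orth c)).
have jvar : jet_poly m.+1 (fun c => theta (ctx_dom c) m (p1 (ctx_poly c) (ctx_deg c))).
  by apply: (jet_poly_var (ab := (0, m))); rewrite /= m0 ltnSn.
have js : jet_poly m.+1 (fun c t => \sum_(i < m) u m i.+1 c t * Dq (m - i.+1) (m.+1 - i.+1) c t).
  apply: (@jet_poly_sum m.+1 m
    (fun i c t => u m i.+1 c t * Dq (m - i.+1) (m.+1 - i.+1) c t)) => i im.
  apply: jet_polyM; first exact: (jet_poly_ucoef jh).
  by apply: (jet_poly_Dquot jh); rewrite subSS leq_subr.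
have := jet_polyM (jet_poly_cst m.+1 m%:R^-1)
  (jet_polyB (jet_polyB jvar (jet_poly_Dquot_top jh m)) js).
apply: jet_poly_ext => c t tO.
(* The term i = 0 would contain the top coefficient [Dq m m.+1] a second time, but u_0 = 0. *)
rewrite (theta_p1 (ctx_orth c)) // big_ord_recl /= ucoef0 mul0r add0r.
rewrite -/(Dq m m.+1 c t).
have -> : \sum_(i < m) ucoef (ctx_dom c) (ctx_poly c) (ctx_deg c) m (bump 0 i) t *
   Dquot (ctx_dom c) (ctx_poly c) (ctx_deg c) (m - bump 0 i) (m.+1 - bump 0 i) t =
   \sum_(i < m) u m i.+1 c t * Dq (m - i.+1) (m.+1 - i.+1) c t by [].
have m0' : m%:R != 0 :> Cx R by rewrite pnatr_eq0 -lt0n.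
have E (x y z : Cx R) : m%:R^-1 * (x + y - (x - m%:R * z) - y) = z by field.
exact: E.
Qed.

End JetPolynomials.

(** * Passage to multivariate polynomials and the shape of the m-th equation *)

Section Conclusion.
Variable R : realType.

(** Inverse of the numbering i = a (m - 1) + b - 1, so that K (m - 1) variables cover all a < K and
    1 <= b < m. *)
Definition jet_index (m i : nat) : nat * nat := (i %/ m.-1, (i %% m.-1).+1)%N.

(** Every [K'] beyond some [K] is allowed, so that two polynomials can be put over common variables
    before being added or multiplied. *)
Lemma jet_poly_mpoly m (F : context R -> param R -> Cx R) : (2 <= m)%N -> jet_poly m F ->
  exists K, forall K', (K <= K')%N ->
    exists U : mpoly.mpoly (K' * m.-1) (Cx R), forall c t, ctx_dom c t ->
      F c t = mpoly.meval (fun i => jet c (jet_index m i) t) U.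
Proof.
move=> m2; elim=> [[a b] /= /andP[b1 bm]|a|{}F G _ [K IF] _ [K2 IG]|
    {}F G _ [K IF] _ [K2 IG]|{}F G FG _ [K IF]].
- exists a.+1 => K' aK.
  have bm1 : (b.-1 < m.-1)%N by rewrite -ltnS !prednK // (leq_trans _ m2).
  have lt : (a * m.-1 + b.-1 < K' * m.-1)%N.
    apply: (@leq_trans (a.+1 * m.-1)); last by rewrite leq_mul2r aK orbT.
    by rewrite mulSn addnC ltn_add2r.
  exists (mpoly.mpolyX (Cx R) (mpoly.mnm1 (Ordinal lt))) => c t _.
  rewrite mpoly.mevalXU /jet_index /= divnMDl ?(leq_ltn_trans _ bm1) //.
  by rewrite divn_small // addn0 modnMDl modn_small // prednK.
- by exists 0%N => K' _; exists (mpoly.mpolyC _ a) => c t _; rewrite mpoly.mevalC.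
- exists (maxn K K2) => K'; rewrite geq_max => /andP[/IF[U FU] /IG[V GV]].
  eexists => c t tO; rewrite (FU c t tO) (GV c t tO).
  exact/esym/mpoly.mevalD.
- exists (maxn K K2) => K'; rewrite geq_max => /andP[/IF[U FU] /IG[V GV]].
  eexists => c t tO; rewrite (FU c t tO) (GV c t tO).
  exact/esym/mpoly.mevalM.
- by exists K => K' /IF[U FU]; exists U => c t tO; rewrite -FG // FU.
Qed.

Lemma ucoef_mpoly m : (2 <= m)%N -> exists K (U : 'I_(m - 2) -> mpoly.mpoly (K * m.-1) (Cx R)),
  forall (c : context R) t (j : 'I_(m - 2)), ctx_dom c t ->
    ucoef (ctx_dom c) (ctx_poly c) (ctx_deg c) m (m - j) t =
    mpoly.meval (fun i => jet c (jet_index m i) t) (U j).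
Proof.
move=> m2.
have /fin_all_exists[K KP] : forall j : 'I_(m - 2), exists K, forall K', (K <= K')%N ->
    exists U : mpoly.mpoly (K' * m.-1) (Cx R), forall (c : context R) t, ctx_dom c t ->
      ucoef (ctx_dom c) (ctx_poly c) (ctx_deg c) m (m - j) t =
      mpoly.meval (fun i => jet c (jet_index m i) t) U.
  move=> j; apply: (jet_poly_mpoly m2 (F := fun c =>
     ucoef (ctx_dom c) (ctx_poly c) (ctx_deg c) m (m - j))).
  by apply: (jet_poly_ucoef (M := m)) => [b bm|]; [exact: jet_poly_dlog|exact: leq_subr].
exists (\max_j K j).
have /fin_all_exists[U UP] := fun j => KP j (\max_j K j) (leq_bigmax j).
by exists U => c t j tO; exact: UP.
Qed.

Variables (v : nat -> Cx R) (Om : set (param R)).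
Variable P : nat -> param R -> {poly Cx R}.
Hypothesis H : deformed_orthogonality v Om P.
Variable n : nat.
Implicit Types (t : param R) (z : Cx R).

(** Reversing the sum of [wave_flow] indexes it by the power of theta_1. The three top terms carry
    u_0 = u_1 = 0 and u_2. *)
Lemma wave_flow_split m z t : (2 <= m)%N -> Om t ->
  theta Om m (wave P n z) t =
    theta_eta Om m (wave P n z) t
    - m%:R * theta_eta Om 1 (p1 P n) t * theta_eta Om (m - 2) (wave P n z) t
    + \sum_(j < m - 2) ucoef Om P n m (m - j) t * theta_eta Om j (wave P n z) t.
Proof.
move=> m2 tO; have m1 : (1 <= m)%N by exact: ltnW.
rewrite (wave_flow H) // -addrA; congr (_ + _).
rewrite (reindex_inj rev_ord_inj) /=.
under eq_bigr => i _ do rewrite subSS (subKn (leq_ord i)).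
case: m m2 m1 => [//|[//|k]] _ _; rewrite subSS subSS subn0.
rewrite 3!big_ord_recr /= subnn subSnn.
have -> : (k.+2 - k = 2)%N by rewrite -addn2 addKn.
by rewrite ucoef0 (ucoef1 H) // (ucoef2 H) // !mul0r !addr0 mulNr addrC.
Qed.

End Conclusion.

#[local] Arguments Dquot : simpl never.

(** * Explicit equations for m = 2, 3 and the KP equation *)

Section KP.
Variables (R : realType) (v : nat -> Cx R) (Om : set (param R)).
Variable P : nat -> param R -> {poly Cx R}.
Hypothesis H : deformed_orthogonality v Om P.
Variable n : nat.
Implicit Types (t : param R) (z : Cx R).
Local Notation smooth := (smooth v Om).
Local Notation dress := (dress P n).
Local Notation Dquot := (Dquot Om P n).
Local Notation dlog := (dlog Om P n).
Local Notation ucoef := (ucoef Om P n).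
Local Notation remainder := (remainder Om P n).
Local Notation p := (p1 P n).
Local Notation th1 := (theta Om 1).
Local Notation th2 := (theta Om 2).
Local Notation th3 := (theta Om 3).

Let l1 : (1 <= 1)%N. Proof. by []. Qed.
Let l2 : (1 <= 2)%N. Proof. by []. Qed.

Let sp : smooth p.
Proof. by rewrite -dress1; exact: (smooth_dress H). Qed.

Let s1 f : smooth f -> smooth (th1 f). Proof. by move=> sf; exact: (smooth_theta H sf). Qed.
Let s2 f : smooth f -> smooth (th2 f). Proof. by move=> sf; exact: (smooth_theta H sf). Qed.
Let s3 f : smooth f -> smooth (th3 f). Proof. by move=> sf; exact: (smooth_theta H sf). Qed.
Let sh i : smooth (dlog i). Proof. exact: (smooth_dlog H). Qed.
Let sDq j i : smooth (Dquot j i). Proof. exact: (smooth_Dquot H). Qed.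

Lemma Dquot_1 r t : Om t -> Dquot 1 r.+1 t = dlog r t.
Proof.
move=> tO; rewrite DquotS /= add0r (theta_cst H l1) // add0r.
by rewrite -[LHS]/(cmul (dlog^~ t) (fun i => (i == 0%N)%:R) r) cmulC cmul1l.
Qed.

Lemma theta_Dquot_1 r t : Om t -> th1 (Dquot 1 r.+1) t = th1 (dlog r) t.
Proof. by move=> tO; apply: (eq_theta H l1 (sDq _ _) _ tO) => t'; exact: Dquot_1. Qed.

Lemma Dquot_2_3 t : Om t -> Dquot 2 3 t = 2 * dlog 2 t + th1 (dlog 1) t.
Proof.
move=> tO; rewrite DquotS Dquot_1 // theta_Dquot_1 // !big_ord_recr big_ord0 /=
  !(subSS, subn0, subnn).
rewrite (dlog0 H) // (Dquot1 H) // Dquot0; ring.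
Qed.

Lemma Dquot_2_4 t : Om t ->
  Dquot 2 4 t = 2 * dlog 3 t + th1 (dlog 2) t + dlog 1 t ^+ 2.
Proof.
move=> tO; rewrite DquotS Dquot_1 // theta_Dquot_1 // !big_ord_recr big_ord0 /=
  !(subSS, subn0, subnn).
rewrite (dlog0 H) // Dquot0 (Dquot1 H) // (Dquot2 H) //; ring.
Qed.

Lemma theta_Dquot2 t : Om t -> th1 (Dquot 2 2) t = 2 * th1 (dlog 1) t.
Proof.
move=> tO; rewrite -(thetaZ H l1) //.
by apply: (eq_theta H l1 (sDq _ _) _ tO) => t' tO'; rewrite (Dquot2 H).
Qed.

Lemma theta_Dquot_2_3 t : Om t ->
  th1 (Dquot 2 3) t = 2 * th1 (dlog 2) t + th1 (th1 (dlog 1)) t.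
Proof.
move=> tO; rewrite -(thetaZ H l1) // -(thetaD H l1) //; last exact: s1.
  by apply: (eq_theta H l1 (sDq _ _) _ tO) => t' tO'; exact: Dquot_2_3.
by apply: smoothM => //; exact: smooth_cst.
Qed.

Lemma Dquot_3_3 t : Om t -> Dquot 3 3 t = 3 * dlog 2 t + 3 * th1 (dlog 1) t.
Proof.
move=> tO; rewrite DquotS Dquot_2_3 // theta_Dquot2 // !big_ord_recr big_ord0 /=
  !(subSS, subn0, subnn).
rewrite (dlog0 H) // (Dquot1 H) // Dquot0; ring.
Qed.

Lemma Dquot_3_4 t : Om t ->
  Dquot 3 4 t = 3 * dlog 3 t + 3 * th1 (dlog 2) t + th1 (th1 (dlog 1)) t + 3 * dlog 1 t ^+ 2.
Proof.
move=> tO; rewrite DquotS Dquot_2_4 // theta_Dquot_2_3 // !big_ord_recr big_ord0 /=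
  !(subSS, subn0, subnn).
rewrite (dlog0 H) // Dquot0 (Dquot1 H) // (Dquot2 H) //; ring.
Qed.

Lemma ucoef_3_3 t : Om t -> ucoef 3 3 t = - (3 * dlog 2 t + 3 * th1 (dlog 1) t).
Proof.
move=> tO; rewrite /ucoef solveE !big_ord_recr big_ord0 /=.
rewrite -/(ucoef 3 0 t) -/(ucoef 3 1 t) -/(ucoef 3 2 t) ucoef0 (ucoef1 H) //.
by rewrite -[Dquot (3 - 2) (3 - 2) t]/(Dquot 1 1 t) (Dquot1 H) // !mul0r mulr0 !addr0
  subr0 sub0r Dquot_3_3.
Qed.

Lemma theta2_p1 t : Om t -> th2 p t = 2 * dlog 2 t + th1 (dlog 1) t.
Proof.
move=> tO; rewrite (theta_p1 H) // !big_ord_recr big_ord0 /=.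
rewrite ucoef0 (ucoef1 H) // -[Dquot (2 - 2) (3 - 2) t]/(0 : Cx R).
by rewrite !mul0r mulr0 !addr0 Dquot_2_3.
Qed.

Lemma theta3_p1 t : Om t ->
  th3 p t = 3 * dlog 3 t + 3 * th1 (dlog 2) t + th1 (th1 (dlog 1)) t.
Proof.
move=> tO; rewrite (theta_p1 H) // !big_ord_recr big_ord0 /=.
rewrite ucoef0 (ucoef1 H) // -[Dquot (3 - 3) (4 - 3) t]/(0 : Cx R).
rewrite -[Dquot (3 - 2) (4 - 2) t]/(Dquot 1 2 t) (ucoef2 H) // (Dquot2 H) // -(dlog1 H) //.
rewrite Dquot_3_4 //; ring.
Qed.

Lemma dlog2_p1 t : Om t -> dlog 2 t = 2^-1 * (th2 p t - th1 (th1 p) t).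
Proof.
move=> tO; rewrite theta2_p1 // (eq_theta H l1 (sh 1) (dlog1 H n) tO).
by rewrite addrK mulKf // pnatr_eq0.
Qed.

(** For m = 2 the remainder is -F_2 beyond order 2, so [theta_dress] leaves its orders 3 and 4
    against S; order 3 of F_2 is theta_2 p^1. *)
Lemma theta2_dress2 t : Om t -> th2 (dress 2) t = Dquot 2 4 t + th2 p t * p t.
Proof.
move=> tO; rewrite (theta_dress H) // -[(2 + 2)%N]/4%N /cmul !big_ord_recr big_ord0 /=.
rewrite !(subSS, subn0, subnn) (remainder_eq0 _ _ _ (r := 0)) // (remainder_eq0 _ _ _ (r := 1)) //.
rewrite (remainder_eq0 _ _ _ (r := 2)) // !mul0r !add0r (dress0 H) // mulr1 dress1.
have E r : (2 < r)%N -> remainder 2 r t = - Dquot 2 r t.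
  case: r => [|[|[|r]]] // _; rewrite /remainder !big_ord_recr big_ord0 /=.
  rewrite ucoef0 (ucoef1 H) // /delay /= subSS subSS subn0.
  by rewrite !mul0r mulr0 !addr0 subr0 sub0r.
rewrite !E // opprD !opprK mulNr opprK addrC; congr (_ + _ * _).
by rewrite theta2_p1 // Dquot_2_3.
Qed.

Lemma theta1_dress2 t : Om t -> th1 (dress 2) t = dlog 2 t + dlog 1 t * p t.
Proof.
move=> tO; rewrite -(cmul_dlog H) // /cmul !big_ord_recr big_ord0 /= subnn.
by rewrite (dlog0 H) // (dress0 H) // mul0r !add0r mulr1 -[(2 - 1)%N]/1%N dress1 addrC.
Qed.

(** Both mixed derivatives of the coefficient of x^2 in S contain the same products with p^1, which
    cancel. *)
Lemma compatibility t : Om t -> th1 (Dquot 2 4) t = th2 (dlog 2) t.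
Proof.
move=> tO.
have sd : smooth (dress 2) by exact: (smooth_dress H).
have := thetaC H sd l1 l2 tO.
rewrite (eq_theta H l1 (s2 sd) theta2_dress2 tO) (eq_theta H l2 (s1 sd) theta1_dress2 tO).
rewrite (thetaD H l1 (sDq 2 4) (smoothM (s2 sp) sp) tO).
rewrite (thetaD H l2 (sh 2) (smoothM (sh 1) sp) tO).
rewrite (thetaM H l1 (s2 sp) sp tO) (thetaM H l2 (sh 1) sp tO).
rewrite (eq_theta H l2 (sh 1) (dlog1 H n) tO) (dlog1 H n tO) (thetaC H sp l1 l2 tO).
by rewrite [th1 p t * _]mulrC => /addIr.
Qed.

(** Let K be the bracket. [compatibility] becomes (theta_1 K - 3 theta_1^2 theta_2 p^1)/6 =
    (theta_2^2 p^1 - theta_2 theta_1^2 p^1)/2, where the mixed terms cancel. *)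
Theorem kp_equation t : Om t ->
  th1 (fun t' => 4 * th3 p t' + 6 * th1 p t' ^+ 2 - th1 (th1 (th1 p)) t') t
  = 3 * th2 (th2 p) t.
Proof.
move=> tO.
have c1 (a : Cx R) f : smooth f -> smooth (fun t => a * f t).
  by move=> sf; apply: smoothM => //; exact: smooth_cst.
have h1p t' : Om t' -> th1 (dlog 1) t' = th1 (th1 p) t'.
  by move=> tO'; exact: (eq_theta H l1 (sh 1) (dlog1 H n) tO').
have h2p t' : Om t' -> th1 (dlog 2) t' = 2^-1 * (th1 (th2 p) t' - th1 (th1 (th1 p)) t').
  move=> tO'; rewrite (eq_theta H l1 (sh 2) dlog2_p1 tO').
  rewrite (thetaZ H l1) //; last by apply: smoothB; [exact: s2|exact/s1/s1].
  by rewrite (thetaB H l1) //; [exact: s2|exact/s1/s1].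
have two0 : (2 : Cx R) != 0 by rewrite pnatr_eq0.
have three0 : (3 : Cx R) != 0 by rewrite pnatr_eq0.
(* Eliminates h_3 ([x3]) through [theta3_p1]; [b] is theta_1 theta_2 p^1 and [d] is theta_1^3
   p^1. *)
have E (x2 x3 t3 b d : Cx R) : t3 = 3 * x3 + 3 * (2^-1 * (b - d)) + d ->
    2 * x3 + 2^-1 * (b - d) + x2 ^+ 2 =
    6^-1 * ((4 * t3 + 6 * x2 ^+ 2 - d) - 3 * b).
  by move=> ->; field.
have k2 t' : Om t' -> Dquot 2 4 t' =
    6^-1 * ((4 * th3 p t' + 6 * th1 p t' ^+ 2 - th1 (th1 (th1 p)) t') - 3 * th1 (th2 p) t').
  move=> tO'; rewrite (Dquot_2_4 tO') (dlog1 H n tO') (h2p t' tO'); apply: E.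
  by rewrite (theta3_p1 tO') (h2p t' tO') (eq_theta H l1 (s1 (sh 1)) h1p tO').
have := compatibility tO.
have sK : smooth (fun t' => 4 * th3 p t' + 6 * th1 p t' ^+ 2 - th1 (th1 (th1 p)) t').
  apply: smoothB; last exact/s1/s1/s1.
  by apply: smoothD; apply: c1; [exact: s3|apply: smoothM; exact: s1].
rewrite (eq_theta H l1 (sDq 2 4) k2 tO) (eq_theta H l2 (sh 2) dlog2_p1 tO).
have s112 : smooth (fun t' => 3 * th1 (th2 p) t') by exact/c1/s1/s2.
rewrite (thetaZ H l1 _ (smoothB sK s112) tO) (thetaB H l1 sK s112 tO).
rewrite (thetaZ H l1 _ (s1 (s2 sp)) tO).
rewrite (thetaZ H l2 _ (smoothB (s2 sp) (s1 (s1 sp))) tO) (thetaB H l2 (s2 sp) (s1 (s1 sp)) tO).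
have thC : th2 (th1 (th1 p)) t = th1 (th1 (th2 p)) t.
  have e1 t' : Om t' -> th2 (th1 p) t' = th1 (th2 p) t' by exact: (thetaC H sp l2 l1).
  have e2 := thetaC H (s1 sp) l2 l1 tO.
  have e3 := eq_theta H l1 (s2 (s1 sp)) e1 tO.
  by apply: (etrans e2); exact e3.
have F (x y w : Cx R) : 6^-1 * (x - 3 * y) = 2^-1 * (w - y) -> x = 3 * w.
  move=> e; have -> : x = 6 * (6^-1 * (x - 3 * y)) + 3 * y by field.
  by rewrite e; field.
by move=> e; exact: F (etrans e (congr1 (fun y => 2^-1 * (_ - y)) thC)).
Qed.

Lemma wave_flow3 z t : Om t ->
  theta Om 3 (wave P n z) t =
    theta_eta Om 3 (wave P n z) t
    - 3 * theta_eta Om 1 p t * theta_eta Om 1 (wave P n z) t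
    - 3 / 2 * (theta_eta Om 2 p t + theta Om 2 p t) * wave P n z t.
Proof.
move=> tO; rewrite (wave_flow_split H) // big_ord1 /= ucoef_3_3 // dlog2_p1 //.
rewrite (eq_theta H l1 (sh 1) (dlog1 H n) tO) /theta_eta /=; congr (_ + _).
rewrite -mulNr; congr (_ * _).
have E (a b : Cx R) : - (3 * (2^-1 * (a - b)) + 3 * b) = - (3 / 2 * (b + a)).
  by field.
exact: E.
Qed.

End KP.

(* The indeterminate of index i of the polynomials U j is evaluated at
   theta_eta^a theta_b p^1_n, where (a, b) = g i and 1 <= b < m. The U j are
   universal: they depend on m only, not on v, the domain, n or t. *)
Theorem proposition20 (R : realType) :
  (forall m : nat, (2 <= m)%N ->
    exists (N : nat) (g : 'I_N -> nat * nat)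
      (U : 'I_(m - 2) -> mpoly.mpoly N (Cx R)),
      (forall i, (1 <= (g i).2 < m)%N) /\
      forall (v : nat -> Cx R) (Om : set (param R))
        (P : nat -> param R -> {poly Cx R}),
        deformed_orthogonality v Om P ->
        forall (n : nat) (t : param R) (z : Cx R), Om t ->
          theta Om m (wave P n z) t =
            theta_eta Om m (wave P n z) t
            - m%:R * theta_eta Om 1 (p1 P n) t
                * theta_eta Om (m - 2) (wave P n z) t
            + \sum_(j < m - 2)
                mpoly.meval
                  (fun i => theta_eta Om (g i).1 (theta Om (g i).2 (p1 P n)) t)
                  (U j)
                * theta_eta Om j (wave P n z) t) /\
  (forall (v : nat -> Cx R) (Om : set (param R))
     (P : nat -> param R -> {poly Cx R}),
     deformed_orthogonality v Om P ->
     forall (n : nat) (t : param R), Om t ->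
     [/\ forall z : Cx R,
           theta Om 2 (wave P n z) t =
             theta_eta Om 2 (wave P n z) t
             - 2 * theta_eta Om 1 (p1 P n) t * wave P n z t,
         forall z : Cx R,
           theta Om 3 (wave P n z) t =
             theta_eta Om 3 (wave P n z) t
             - 3 * theta_eta Om 1 (p1 P n) t * theta_eta Om 1 (wave P n z) t
             - 3 / 2 * (theta_eta Om 2 (p1 P n) t + theta Om 2 (p1 P n) t)
                 * wave P n z t
       & theta_eta Om 1
           (fun t' => 4 * theta Om 3 (p1 P n) t'
                      + 6 * theta_eta Om 1 (p1 P n) t' ^+ 2
                      - theta_eta Om 3 (p1 P n) t') t =
         3 * theta Om 2 (theta Om 2 (p1 P n)) t]).

Proof.
split=> [m m2|v Om P H n t tO].
  have [K [U UP]] := @ucoef_mpoly R m m2.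
  exists (K * m.-1)%N, (jet_index m), U; split=> [i|v Om P H n t z tO].
    rewrite /jet_index /= -[X in (_ < X)%N]prednK ?ltnS; last exact: ltnW.
    by rewrite ltn_mod -ltnS prednK // ltnW.
  rewrite (wave_flow_split H) //; congr (_ + _); apply: eq_bigr => j _.
  by rewrite (UP (Context n H) t j tO).
split=> [z|z|].
(* For m = 2 the sum of lower terms is empty. *)
- by rewrite (wave_flow_split H) // big_ord0 addr0.
- exact: (wave_flow3 H).
- exact: (kp_equation H).
Qed.
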